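(* Let $a,b\in\overline{{}^\bullet\mathbb{R}}$ and let $J$ be a non-infinitesimal interval of ${}^\bullet\mathbb{R}$ with endpoints $a,b$. Let $f:J\to{}^\bullet\mathbb{R}$ be a smooth function and let $u\in J$. Then there exists one and only one smooth function $I:J\to{}^\bullet\mathbb{R}$ such that $I'=f$ on $J$ and $I(u)=0$.
   Context: Fermat reals: let $\mathbb{R}_o[t]$ be the set of maps $x:\mathbb{R}_{\ge0}\to\mathbb{R}$, $t\mapsto x_t$, of the form $x_t=r+\sum_{i=1}^k\alpha_i t^{a_i}+o(t)$ as $t\to0^+$, with $k\in\mathbb{N}$, $r,\alpha_i\in\mathbb{R}$, $a_i\in\mathbb{R}_{\ge0}$. Write $x\sim y$ iff $x_t=y_t+o(t)$ as $t\to0^+$. The ring of Fermat reals is ${}^\bullet\mathbb{R}:=\mathbb{R}_o[t]/\sim$ with pointwise operations; $\mathbb{R}\subseteq{}^\bullet\mathbb{R}$ via constants. The standard part of $x=[x_t]$ is ${}^\circ x:=x_0$ (componentwise on ${}^\bullet\mathbb{R}^n$). ${}^\bullet\mathbb{R}$ is totally ordered by: $x\le y$ iff for representatives there is $z\in\mathbb{R}_o[t]$ with $z\sim0$ and $x_t\le y_t+z_t$ for all small $t\ge0$. $\overline{{}^\bullet\mathbb{R}}:={}^\bullet\mathbb{R}\cup\{\pm\infty\}$, ${}^\circ(\pm\infty):=\pm\infty$. An interval is a set $[a,b],(a,b),[a,b),(a,b]$ of points of ${}^\bullet\mathbb{R}$ with $a\le b$ in $\overline{{}^\bullet\mathbb{R}}$;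 non-infinitesimal if ${}^\circ a<{}^\circ b$. The Fermat topology on ${}^\bullet\mathbb{R}^n$ has open sets ${}^\bullet V:=\{x:{}^\circ x\in V\}$, $V\subseteq\mathbb{R}^n$ open. For $\alpha\in C^\infty(W,\mathbb{R}^m)$, $W\subseteq\mathbb{R}^d$ open, ${}^\bullet\alpha([x_t]):=[\alpha(x_t)]$. A map $f:S\to{}^\bullet\mathbb{R}^m$, $S\subseteq{}^\bullet\mathbb{R}^n$, is smooth (quasi-standard smooth) if for every $x\in S$ there exist open $V\subseteq\mathbb{R}^n$ with $x\in{}^\bullet V$, open $P\subseteq\mathbb{R}^{\mathsf p}$, $p\in{}^\bullet P$ and $\alpha\in C^\infty(P\times V,\mathbb{R}^m)$ with $f(y)={}^\bullet\alpha(p,y)$ for all $y\in{}^\bullet V\cap S$. For $f$ smooth on a non-infinitesimal interval $J$ and $x\in J$, $f'(x):={}^\bullet(\partial_2\alpha)(p,x)$ for any such local representation of $f$ around $x$ (independent of the representation; equivalently $f'(x)=r(x,0)$ where $r$ is the unique smooth function with $f(x+h)=f(x)+h\,r(x,h)$ for all sufficiently small $h$ with $x+h\in J$). *)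

(* Defs.v *)
From HB Require Import structures.
From mathcomp Require Import all_boot all_order all_algebra.
From mathcomp Require Import all_classical all_reals all_analysis.
From Stdlib Require Import ClassicalEpsilon.
Set Implicit Arguments. Unset Strict Implicit. Unset Printing Implicit Defensive.
Import Order.TTheory GRing.Theory Num.Theory.
Import numFieldNormedType.Exports.
Local Open Scope classical_set_scope.
Local Open Scope ring_scope.

Section FermatReals.
Variable R : realType.

(* h(t) = o(t) as t -> 0^+, for h defined on R_{>=0} (so in particular h 0 = 0) *)
Definition little_o (h : R -> R) : Prop :=
  forall e : R, 0 < e -> exists2 d : R, 0 < d &
    forall t : R, 0 <= t -> t < d -> `|h t| <= e * t.

(* R_o[t]: x_t = r + sum_i alpha_i t^{a_i} + o(t), with a_i >= 0
   (powR implements t^a with 0^0 = 1 and 0^a = 0 for a > 0) *)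
Definition Ro (x : R -> R) : Prop :=
  exists (r : R) (l : seq (R * R)),
    (forall q, q \in l -> 0 <= q.2) /\
    little_o (fun t => x t - (r + \sum_(q <- l) q.1 * powR t q.2)).

Definition fequiv (x y : R -> R) : Prop := little_o (fun t => x t - y t).

Definition canon (x : R -> R) : R -> R :=
  epsilon (inhabits (fun _ => 0)) (fun y => Ro y /\ fequiv x y).

(* The Fermat reals  R_o[t] / ~ , realized as the set of canonical
   representatives *)
Definition FR : Type := {x : R -> R | Ro x /\ canon x = x}.

Definition rep (x : FR) : R -> R := proj1_sig x.

Definition std (x : FR) : R := rep x 0.

Definition FR_is_real (x : FR) (r : R) : Prop := fequiv (rep x) (fun _ => r).

Definition FRle (x y : FR) : Prop :=
  exists z : R -> R, [/\ Ro z, fequiv z (fun _ => 0) &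
    exists2 d : R, 0 < d & forall t, 0 <= t -> t < d -> rep x t <= rep y t + z t].

Inductive FRbar : Type := FFin of FR | FPinf | FMinf.

Definition FRbar_le (u v : FRbar) : Prop :=
  match u, v with
  | FMinf, _ => True
  | _, FPinf => True
  | FFin x, FFin y => FRle x y
  | _, _ => False
  end.

Definition FRbar_lt (u v : FRbar) : Prop := FRbar_le u v /\ u <> v.

Definition stdbar (u : FRbar) : \bar R :=
  match u with FFin x => (std x)%:E | FPinf => +oo%E | FMinf => -oo%E end.

Inductive ikind := CC | OO | CO | OC.

Definition in_interval (k : ikind) (a b : FRbar) (x : FR) : Prop :=
  match k with
  | CC => FRbar_le a (FFin x) /\ FRbar_le (FFin x) b
  | OO => FRbar_lt a (FFin x) /\ FRbar_lt (FFin x) b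
  | CO => FRbar_le a (FFin x) /\ FRbar_lt (FFin x) b
  | OC => FRbar_lt a (FFin x) /\ FRbar_le (FFin x) b
  end.

Definition FR_interval (a b : FRbar) : Prop := FRbar_le a b.

Definition non_infinitesimal (a b : FRbar) : Prop := (stdbar a < stdbar b)%E.

Definition partial (n : nat) (g : 'rV[R]_n -> R) (i : 'I_n) : 'rV[R]_n -> R :=
  fun z => derive g z (delta_mx 0 i).

Definition iter_partial (n : nat) (s : seq 'I_n) (g : 'rV[R]_n -> R) :=
  foldr (fun i h => partial h i) g s.

Definition Cinf_on (n : nat) (W : set 'rV[R]_n) (g : 'rV[R]_n -> R) : Prop :=
  forall (s : seq 'I_n) (z : 'rV[R]_n), W z ->
    {for z, continuous (iter_partial s g)} /\
    forall i : 'I_n, derivable (iter_partial s g) z (delta_mx 0 i).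

Definition ext_rep (pp : nat) (alpha : 'rV[R]_(pp + 1) -> R)
    (p : 'I_pp -> FR) (y : FR) : R -> R :=
  fun t => alpha (row_mx (\row_i rep (p i) t) (\row_(j < 1) rep y t)).

Definition last_coord (pp : nat) : 'I_(pp + 1) := rshift pp (ord0 : 'I_1).

(* local quasi-standard representation of f : S -> FR around x (n = m = 1):
   open V ⊆ R with x ∈ ^•V, open P ⊆ R^pp, p ∈ ^•P, alpha ∈ C^∞(P × V, R),
   f(y) = ^•alpha(p,y) for all y ∈ ^•V ∩ S *)
Definition local_rep (S : set FR) (f : FR -> FR) (x : FR) (V : set R)
    (pp : nat) (P : set 'rV[R]_pp) (p : 'I_pp -> FR)
    (alpha : 'rV[R]_(pp + 1) -> R) : Prop :=
  [/\ open V /\ V (std x), open P /\ P (\row_(i < pp) std (p i)),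
      Cinf_on (fun z => P (lsubmx z) /\ V (rsubmx z ord0 ord0)) alpha &
      forall y, S y -> V (std y) -> fequiv (rep (f y)) (ext_rep alpha p y)].

Definition smooth_on (S : set FR) (f : FR -> FR) : Prop :=
  forall x, S x -> exists (V : set R) (pp : nat) (P : set 'rV[R]_pp)
    (p : 'I_pp -> FR) (alpha : 'rV[R]_(pp + 1) -> R),
    local_rep S f x V P p alpha.

Definition deriv_is (S : set FR) (f : FR -> FR) (x d : FR) : Prop :=
  forall (V : set R) (pp : nat) (P : set 'rV[R]_pp) (p : 'I_pp -> FR)
    (alpha : 'rV[R]_(pp + 1) -> R),
    local_rep S f x V P p alpha ->
    fequiv (rep d) (ext_rep (partial alpha (last_coord pp)) p x).

End FermatReals.

(* Main.v *)
Require Import Defs.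
From mathcomp Require Import all_boot all_order all_algebra.
From mathcomp Require Import all_classical all_reals all_analysis.
From mathcomp Require Import ring lra.
From Stdlib Require Import ClassicalEpsilon.
Set Implicit Arguments. Unset Strict Implicit. Unset Printing Implicit Defensive.
Import Order.TTheory GRing.Theory Num.Theory.
Import numFieldNormedType.Exports.
Local Open Scope classical_set_scope.
Local Open Scope ring_scope.

(* Both halves of the theorem rest on one observation.  If [alpha] is smooth,
   [p], [x], [y] are Fermat reals and [x^th = x + th (y - x)], Taylor expansion
   around the standard parts, pushed to an order killing [t], gives
   [alpha(p_t, x^th_t) = sum_j w_j(t) phi_j(th) + o(t)], a finite sum with
   continuous [phi_j], uniformly in [th] in [0, 1].  By elimination among the
   [w_j], if such a sum is [o(t)] for every real [th], then it is so uniformly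
   in [th], and the same holds after differentiating the [phi_j].
   Differentiating along [y = x + h] with [h] real shows that [I'(x)] does not
   depend on the local representation of [I]; the uniform estimate and the mean
   value theorem show that a function with zero derivative is locally constant,
   hence constant, since the standard parts of the points of [J] form an
   interval.  For existence, a local representation [alpha(p, -)] of [f] has the
   smooth primitive [int_c^x alpha(p, s) ds]; local primitives are glued after
   adding a Fermat real, which becomes an additional parameter of the
   representation. *)

(** * Germs at 0+ and the ring of Fermat reals *)

Section Germs.
Variable R : realType.
Implicit Types (t e : R) (h x y : R -> R) (P Q : R -> Prop).

(** The obstacle is a quantifier. A representation fixes [I y] only up to [o(t)], separately for
    each [y], so the range of [t] on which an error bound holds depends on [y]. Neither
    differentiation in [th] nor the mean value theorem tolerates this: the mean value point moves
    with [t]. A finite number of weights repairs it, since relations at finitely many real [th] then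
    control all of them. A killing order exists because [x_t - x_0] is bounded by [C t^c] with
    [c > 0]: an order [N] with [c N >= 2] leaves a remainder below a multiple of [t^2]. The step [h]
    is a nonzero real because the estimate is divided by it; as [J] is non-infinitesimal, such a
    step to the left or to the right stays in [J], even from an end point. *)

Definition ev0 P := exists2 d : R, 0 < d & forall t, 0 <= t -> t < d -> P t.

Lemma ev0W P Q : (forall t, 0 <= t -> P t -> Q t) -> ev0 P -> ev0 Q.
Proof. by move=> PQ [d d0 Pd]; exists d => // t t0 td; apply: PQ => //; exact: Pd. Qed.

Lemma ev0T P : (forall t, 0 <= t -> P t) -> ev0 P.
Proof. by move=> PP; exists 1 => // t t0 _; exact: PP. Qed.

Lemma ev0I P Q : ev0 P -> ev0 Q -> ev0 (fun t => P t /\ Q t).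
Proof.
move=> [d d0 Pd] [d' d'0 Qd]; exists (Num.min d d').
  by rewrite lt_min d0.
by move=> t t0; rewrite lt_min => /andP[td td']; split; [exact: Pd|exact: Qd].
Qed.

Lemma ev0_lt e : 0 < e -> ev0 (fun t => t < e).
Proof. by move=> e0; exists e. Qed.

Lemma ev0_forall n (P : 'I_n -> R -> Prop) :
  (forall i, ev0 (P i)) -> ev0 (fun t => forall i, P i t).
Proof.
elim: n P => [|n IH] P HP; first by apply: ev0T => t _ [].
apply: ev0W (ev0I (HP ord0) (IH (fun i => P (lift ord0 i)) (fun i => HP _))).
move=> t _ [P0 PS] i.
by case: (unliftP ord0 i) => [j ->|->].
Qed.

Lemma little_oW h h' : (forall t, 0 <= t -> `|h' t| <= `|h t|) ->
  little_o h -> little_o h'.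
Proof.
by move=> hh' ho e /ho; apply: ev0W => t t0; apply: le_trans; exact: hh'.
Qed.

Lemma little_o_ev h h' : ev0 (fun t => h' t = h t) -> little_o h -> little_o h'.
Proof.
by move=> hh' ho e /ho /(ev0I hh'); apply: ev0W => t t0 [-> ].
Qed.

Lemma little_o_eq h h' : (forall t, 0 <= t -> h' t = h t) ->
  little_o h -> little_o h'.
Proof. by move=> hh'; apply: little_o_ev; exact: ev0T. Qed.

Lemma little_o0 : little_o (fun _ : R => 0).
Proof. by move=> e e0; apply: ev0T => t t0; rewrite normr0 mulr_ge0// ltW. Qed.

Lemma little_oD h h' : little_o h -> little_o h' ->
  little_o (fun t => h t + h' t).
Proof.
move=> ho ho' e e0; have e2 : 0 < e / 2 by rewrite divr_gt0.
apply: ev0W (ev0I (ho _ e2) (ho' _ e2)) => t t0 [A B].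
by apply: le_trans (ler_normD _ _) _; lra.
Qed.

Lemma little_oN h : little_o h -> little_o (fun t => - h t).
Proof. by apply: little_oW => t _; rewrite normrN. Qed.

Lemma little_oB h h' : little_o h -> little_o h' ->
  little_o (fun t => h t - h' t).
Proof. by move=> ho ho'; apply: little_oD => //; exact: little_oN. Qed.

Definition bounded0 h := exists2 M : R, 0 < M & ev0 (fun t => `|h t| <= M).

Lemma little_oM (k h : R -> R) : bounded0 k -> little_o h ->
  little_o (fun t => k t * h t).
Proof.
move=> [M M0 kM] ho e e0.
have eM : 0 < e / M by rewrite divr_gt0.
apply: ev0W (ev0I kM (ho _ eM)) => t t0 [A B].
rewrite normrM; apply: le_trans (ler_pM _ _ A B) _ => //.
by rewrite mulrA mulrCA divff ?mulr1 ?gt_eqF.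
Qed.

Lemma bounded0_cst (c : R) : bounded0 (fun _ => c).
Proof.
by exists (`|c| + 1); [rewrite ltr_wpDl|apply: ev0T => t t0; rewrite lerDl].
Qed.

Lemma little_oZ (c : R) h : little_o h -> little_o (fun t => c * h t).
Proof. exact: little_oM (bounded0_cst c). Qed.

Lemma little_o_sum (I : Type) (r : seq I) (F : I -> R -> R) :
  (forall i, little_o (F i)) -> little_o (fun t => \sum_(i <- r) F i t).
Proof.
move=> Fo; elim: r => [|i r IH].
  by apply: little_o_eq little_o0 => t _; rewrite big_nil.
by apply: little_o_eq (little_oD (Fo i) IH) => t _; rewrite big_cons.
Qed.

Lemma fequiv_refl x : fequiv x x.
Proof. by apply: little_o_eq little_o0 => t _; rewrite subrr. Qed.

Lemma fequiv_sym x y : fequiv x y -> fequiv y x.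
Proof. by apply: little_oW => t _; rewrite distrC. Qed.

Lemma fequiv_trans y x z : fequiv x y -> fequiv y z -> fequiv x z.
Proof.
by move=> xy yz; apply: little_o_eq (little_oD xy yz) => t _; ring.
Qed.

Lemma fequiv_ev x y : ev0 (fun t => x t = y t) -> fequiv x y.
Proof.
by move=> xy; apply: little_o_ev little_o0; apply: ev0W xy => t _ ->; rewrite subrr.
Qed.

Lemma fequivD x x' y y' : fequiv x x' -> fequiv y y' ->
  fequiv (fun t => x t + y t) (fun t => x' t + y' t).
Proof.
by move=> xx yy; apply: little_o_eq (little_oD xx yy) => t _; ring.
Qed.

Lemma fequivB x x' y y' : fequiv x x' -> fequiv y y' ->
  fequiv (fun t => x t - y t) (fun t => x' t - y' t).
Proof.
by move=> xx yy; apply: little_o_eq (little_oB xx yy) => t _; ring.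
Qed.

(** Germs include [t = 0], where the bound [e * t] vanishes; this makes [std] invariant under
    [fequiv]. *)
Lemma fequiv0 x y : fequiv x y -> x 0 = y 0.
Proof.
move=> /(_ 1 ltr01) [d d0 /(_ 0 (lexx _) d0)].
by rewrite mulr0 normr_le0 subr_eq0 => /eqP.
Qed.

(** Unlike [o(t)], this rate allows exponents below 1, and it is shared by all [x - x 0] with [x] in
    [Ro]. It forces [h 0 = 0], since [0 ^ c = 0]. *)
Definition holder0 h :=
  exists c C : R, [/\ 0 < c, 0 <= C & ev0 (fun t => `|h t| <= C * t `^ c)].

Lemma powR_le_exp t (a b : R) : 0 < a -> a <= b -> 0 <= t -> t <= 1 ->
  t `^ b <= t `^ a.
Proof.
move=> a0 ab; rewrite le_eqVlt => /orP[/eqP <- _|t0 t1].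
  by rewrite !powR0// gt_eqF// (lt_le_trans a0).
by apply: ger_powR => //; rewrite t0.
Qed.

Lemma holder0D h h' : holder0 h -> holder0 h' -> holder0 (fun t => h t + h' t).
Proof.
move=> [c [C [c0 C0 H]]] [c' [C' [c'0 C'0 H']]].
exists (Num.min c c'), (C + C'); split; [by rewrite lt_min c0|exact: addr_ge0|].
have m0 : 0 < Num.min c c' by rewrite lt_min c0.
apply: ev0W (ev0I (ev0_lt ltr01) (ev0I H H')) => t t0 [t1 [A B]].
rewrite mulrDl; apply: le_trans (ler_normD _ _) _; apply: lerD.
  apply: le_trans A _; apply: ler_wpM2l => //; apply: powR_le_exp => //.
    by rewrite ge_min lexx.
  exact: ltW.
apply: le_trans B _; apply: ler_wpM2l => //; apply: powR_le_exp => //.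
  by rewrite ge_min lexx orbT.
exact: ltW.
Qed.

Lemma little_o_holder0 h : little_o h -> holder0 h.
Proof.
move=> /(_ 1 ltr01) H; exists 1, 1; split => //.
by apply: ev0W H => t t0; rewrite powRr1.
Qed.

Lemma holder0_bounded h : holder0 h -> bounded0 h.
Proof.
move=> [c [C [c0 C0 H]]]; exists (C + 1); first by rewrite ltr_wpDl.
apply: ev0W (ev0I (ev0_lt ltr01) H) => t t0 [t1 A].
apply: le_trans A _; apply: (@le_trans _ _ (C * 1)); last by rewrite mulr1 lerDl.
rewrite ler_wpM2l// -(powRr0 t).
move: t0; rewrite le_eqVlt => /orP[/eqP <-|t0].
  by rewrite powR0 ?gt_eqF// powRr0.
by apply: ger_powR; [rewrite t0 ltW|exact: ltW].
Qed.

Lemma bounded0D h h' : bounded0 h -> bounded0 h' -> bounded0 (fun t => h t + h' t).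
Proof.
move=> [M M0 H] [M' M'0 H']; exists (M + M'); first exact: addr_gt0.
by apply: ev0W (ev0I H H') => t t0 [A B]; apply: le_trans (ler_normD _ _) _; apply: lerD.
Qed.

Lemma holder0_small h e : 0 < e -> holder0 h -> ev0 (fun t => `|h t| < e).
Proof.
move=> e0 [c [C [c0 C0 H]]].
have C1 : 0 < C + 1 by rewrite ltr_wpDl.
have eC : 0 < e / (C + 1) by rewrite divr_gt0.
have d0 : 0 < (e / (C + 1)) `^ c^-1 by exact: powR_gt0.
apply: ev0W (ev0I (ev0_lt d0) H) => t t0 [td A].
apply: le_lt_trans A _.
have B : t `^ c < e / (C + 1).
  have <- : ((e / (C + 1)) `^ c^-1) `^ c = e / (C + 1).
    by rewrite -powRrM mulVf ?lt0r_neq0// powRr1// ltW.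
  by apply: (gt0_ltr_powR c0); rewrite ?nnegrE ?powR_ge0.
apply: (@le_lt_trans _ _ ((C + 1) * t `^ c)); last by rewrite mulrC -ltr_pdivlMr.
by rewrite ler_wpM2r ?powR_ge0// lerDl.
Qed.

(** With [c * N >= 2] the power is at most [C ^ N * t ^ 2] for [t < 1], and the spare factor [t]
    absorbs the constant. This [N] becomes the Taylor order. *)
Lemma powR_pow_small (c C : R) : 0 < c -> 0 <= C ->
  exists N : nat, little_o (fun t => (C * t `^ c) ^+ N).
Proof.
move=> c0 C0.
pose N := (Num.trunc (2 / c)).+1.
have N2 : 2 <= c * N%:R.
  have : 2 / c < N%:R by exact: truncnS_gt.
  by rewrite ltr_pdivrMr// mulrC => /ltW.
exists N => e e0.
have CN : 0 < C ^+ N + 1 by rewrite ltr_wpDl// exprn_ge0.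
have eC : 0 < e / (C ^+ N + 1) by rewrite divr_gt0.
apply: ev0W (ev0I (ev0_lt eC) (ev0_lt ltr01)) => t t0 [te t1].
rewrite ger0_norm ?exprn_ge0 ?mulr_ge0 ?powR_ge0// exprMn.
rewrite -(powR_mulrn N (powR_ge0 t c)) -powRrM; apply: (@le_trans _ _ (C ^+ N * t ^+ 2)).
  rewrite ler_wpM2l ?exprn_ge0// -(powR_mulrn 2 t0).
  by apply: powR_le_exp => //; exact: ltW.
rewrite expr2 mulrA ler_wpM2r//.
apply: (@le_trans _ _ ((C ^+ N + 1) * t)); first by rewrite ler_wpM2r// lerDl.
by rewrite mulrC -ler_pdivlMr// ltW.
Qed.

End Germs.

(** * Power sums and closure of [Ro] under ring operations *)

Section PowerSums.
Variable R : realType.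
Implicit Types (x y : R -> R) (l m : seq (R * R)).

Definition powsum l (t : R) := \sum_(q <- l) q.1 * t `^ q.2.

Lemma RoI x l : (forall q, q \in l -> 0 <= q.2) -> fequiv x (powsum l) -> Ro x.
Proof.
move=> l0 xl; exists 0, l; split => //.
by apply: little_o_eq xl => t _; rewrite add0r.
Qed.

(** The constant term joins the sum as a power with exponent 0, also at [t = 0] because
    [0 ^ 0 = 1]. *)
Lemma RoP x : Ro x ->
  exists2 l, (forall q, q \in l -> 0 <= q.2) & fequiv x (powsum l).
Proof.
move=> [r [l [l0 xl]]]; exists ((r, 0) :: l).
  by move=> q; rewrite in_cons => /orP[/eqP ->//|/l0].
by apply: little_o_eq xl => t _; rewrite /powsum big_cons /= powRr0 mulr1.
Qed.

Lemma Ro_fequiv x y : Ro x -> fequiv x y -> Ro y.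
Proof.
move=> /RoP[l l0 xl] xy; apply: RoI l0 _.
exact: fequiv_trans (fequiv_sym xy) xl.
Qed.

Lemma Ro_cst (c : R) : Ro (fun _ => c).
Proof.
apply: (@RoI _ [:: (c, 0)]) => [q|]; first by rewrite inE => /eqP ->.
apply: fequiv_ev; apply: ev0T => t _.
by rewrite /powsum big_seq1/= powRr0 mulr1.
Qed.

Lemma Ro_little_o x : little_o x -> Ro x.
Proof.
move=> xo; apply: (@Ro_fequiv (fun=> 0)); first exact: Ro_cst.
by apply: fequiv_sym; apply: little_o_eq xo => t _; rewrite subr0.
Qed.

Lemma RoD x y : Ro x -> Ro y -> Ro (fun t => x t + y t).
Proof.
move=> /RoP[l l0 xl] /RoP[m m0 ym]; apply: (@RoI _ (l ++ m)).
  by move=> q; rewrite mem_cat => /orP[/l0|/m0].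
by apply: little_o_eq (fequivD xl ym) => t _; rewrite /powsum big_cat.
Qed.

Lemma powsum_holder0 l : (forall q, q \in l -> 0 <= q.2) ->
  holder0 (fun t => powsum l t - powsum l 0).
Proof.
elim: l => [|[a b] l IH] l0.
  apply: little_o_holder0; apply: little_o_eq (@little_o0 R) => t _.
  by rewrite /powsum !big_nil subrr.
have b0 : 0 <= b by have := l0 (a, b); rewrite mem_head; exact.
have {}IH := IH (fun q ql => l0 q (mem_behead (s := (a, b) :: l) ql)).
have : holder0 (fun t => a * t `^ b - a * 0 `^ b).
  have [->|bn] := eqVneq b 0.
    apply: little_o_holder0; apply: little_o_eq (@little_o0 R) => t _.
    by rewrite !powRr0 subrr.
  exists b, `|a|; split => //; first by rewrite lt_neqAle eq_sym bn.
  apply: ev0T => t t0; rewrite powR0// mulr0 subr0 normrM.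
  by rewrite (ger0_norm (powR_ge0 _ _)).
move=> /holder0D /(_ IH).
by congr (holder0 _); apply/funext => t; rewrite /powsum !big_cons/=; ring.
Qed.

Lemma Ro_holder0 x : Ro x -> holder0 (fun t => x t - x 0).
Proof.
move=> /RoP[l l0 xl].
have := holder0D (little_o_holder0 xl) (powsum_holder0 l0).
congr (holder0 _); apply/funext => t.
by rewrite (fequiv0 xl); ring.
Qed.

Lemma Ro_bounded x : Ro x -> bounded0 x.
Proof.
move=> /Ro_holder0 /holder0_bounded xb.
have := bounded0D xb (bounded0_cst (x 0)).
by congr (bounded0 _); apply/funext => t; rewrite subrK.
Qed.

(** At [t = 0] additivity of exponents fails for opposite nonzero [a] and [b]; the signs exclude
    this. *)
Lemma powRD_ge0 (t a b : R) : 0 <= a -> 0 <= b ->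
  t `^ (a + b) = t `^ a * t `^ b.
Proof.
move=> a0 b0; have [->|tn] := eqVneq t 0; last first.
  by apply: powRD; apply/implyP.
have [->|an] := eqVneq a 0; first by rewrite add0r powRr0 mul1r.
have ab : 0 < a + b by rewrite ltr_wpDr// lt_neqAle eq_sym an.
by rewrite (powR0 an) powR0 ?mul0r// gt_eqF.
Qed.

Lemma powsumM l m : (forall q, q \in l -> 0 <= q.2) ->
  (forall q, q \in m -> 0 <= q.2) -> forall t, powsum l t * powsum m t =
  powsum [seq (q.1 * q'.1, q.2 + q'.2) | q <- l, q' <- m] t.
Proof.
move=> l0 m0 t; rewrite /powsum big_allpairs_dep /= big_distrlr /=.
rewrite big_seq [RHS]big_seq; apply: eq_bigr => q ql.
rewrite big_seq [RHS]big_seq; apply: eq_bigr => q' qm.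
by rewrite mulrACA -powRD_ge0//; [exact: l0|exact: m0].
Qed.

Lemma RoM x y : Ro x -> Ro y -> Ro (fun t => x t * y t).
Proof.
move=> Rx Ry.
have [l l0 xl] := RoP Rx; have [m m0 ym] := RoP Ry.
apply: (@RoI _ [seq (q.1 * q'.1, q.2 + q'.2) | q <- l, q' <- m]).
  by move=> q /allpairsP[[q1 q2] /= [/l0 A /m0 B ->]]; exact: addr_ge0.
have lb : bounded0 (powsum l) by apply: Ro_bounded; apply: RoI l0 _; exact: fequiv_refl.
have := little_oD (little_oM (Ro_bounded Ry) xl) (little_oM lb ym).
by apply: little_o_eq => t _; rewrite -powsumM//; ring.
Qed.

Lemma Ro_sum (I : Type) (r : seq I) (F : I -> R -> R) :
  (forall i, Ro (F i)) -> Ro (fun t => \sum_(i <- r) F i t).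
Proof.
move=> Fo; elim: r => [|i r IH].
  by under eq_fun do rewrite big_nil; exact: Ro_cst.
by under eq_fun do rewrite big_cons; exact: RoD.
Qed.

End PowerSums.

(** * Fermat reals as canonical representatives *)

Section Points.
Variable R : realType.
Implicit Types (x y : FR R).

Lemma canon_spec (z : R -> R) : Ro z -> Ro (Defs.canon z) /\ fequiv z (Defs.canon z).
Proof.
move=> Rz.
apply: (@epsilon_spec _ _ (fun w => Ro w /\ fequiv z w)).
by exists z; split => //; exact: fequiv_refl.
Qed.

(** Equivalent germs define the same predicate, by extensionality, so [epsilon] returns the same
    witness; the quotient thus gets Leibniz equality. *)
Lemma canon_eq (z z' : R -> R) : fequiv z z' -> Defs.canon z = Defs.canon z'.
Proof.
move=> zz; rewrite /Defs.canon; congr epsilon; apply/funext => w; apply/propext.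
split=> -[Rw H]; split => //; last exact: fequiv_trans zz H.
exact: fequiv_trans (fequiv_sym zz) H.
Qed.

Lemma FR_exists (z : R -> R) : Ro z -> exists x : FR R, fequiv (rep x) z.
Proof.
move=> Rz; have [Rc zc] := canon_spec Rz.
by exists (exist _ (Defs.canon z) (conj Rc (esym (canon_eq zc)))); exact: fequiv_sym.
Qed.

Lemma Ro_rep x : Ro (rep x).
Proof. by case: x => z []. Qed.

Lemma FR_ext x y : fequiv (rep x) (rep y) -> x = y.
Proof.
case: x y => x [Rx cx] [y [Ry cy]] /= xy.
have E : x = y by rewrite -cx -cy; exact: canon_eq.
by subst y; congr exist; exact: Prop_irrelevance.
Qed.

Lemma FR_inhabited : inhabited (FR R).
Proof. by have [x _] := FR_exists (Ro_cst (0 : R)); constructor. Qed.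

Definition toFR (z : R -> R) : FR R :=
  epsilon FR_inhabited (fun x => fequiv (rep x) z).

Lemma toFRP (z : R -> R) : Ro z -> fequiv (rep (toFR z)) z.
Proof. by move=> /FR_exists; exact: epsilon_spec. Qed.

Lemma rep_holder0 x : holder0 (fun t => rep x t - std x).
Proof. exact: Ro_holder0 (Ro_rep x). Qed.

End Points.

(** * One-variable calculus *)

Section Calculus.
Variable R : realType.

(** Multiplying the difference quotient by [h] removes the punctured neighbourhood: at [h = 0] the
    inequality is trivial. A general [V] covers real functions and directional derivatives at
    once. *)
Lemma is_deriveP (V : normedModType R) (f : V -> R) (z v : V) (L : R) :
  is_derive z v f L <-> (forall e : R, 0 < e -> exists2 d : R, 0 < d &
    forall h : R, `|h| < d -> `|f (z + h *: v) - f z - h * L| <= e * `|h|).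
Proof.
split=> [[df <-] e e0|H].
  move: df => /cvgrPdist_le /(_ _ e0) /= /nbhs_ballP[d d0 Hd].
  exists d => // h hd; have [->|h0] := eqVneq h 0.
    by rewrite scale0r addr0 subrr mul0r subrr normr0 mulr0.
  have /(_ _ h0) := Hd h _.
  rewrite /ball/= sub0r normrN => /(_ hd).
  rewrite /derive [h *: v + z]addrC.
  set D := lim _; set F := f _ - f z => A.
  have -> : F - h * D = - (h * (D - h^-1 *: F)).
    by rewrite mulrBr /GRing.scale/= mulrA divff// mul1r opprB.
  by rewrite normrN normrM mulrC ler_wpM2r.
suff HL : h^-1 *: (f (h *: v + z) - f z) @[h --> 0^'] --> L.
  by split; [exact: cvgP HL|exact: cvg_lim HL].
apply/cvgrPdist_le => /= e e0; have [d d0 Hd] := H e e0.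
apply/nbhs_ballP; exists d => //= h; rewrite /ball/= sub0r normrN => hd h0.
have h1 : 0 < `|h| by rewrite normr_gt0.
rewrite -(ler_pM2r h1) -normrM [h *: v + z]addrC.
have := Hd _ hd; set F := f _ - f z => A.
have -> : (L - h^-1 *: F) * h = - (F - h * L).
  by rewrite mulrBl /GRing.scale/= mulrAC mulVf// mul1r; ring.
by rewrite normrN.
Qed.

Lemma is_derive_quad (V : normedModType R) (f : V -> R) (z v : V) (L C d : R) :
  0 < d -> (forall h : R, `|h| < d ->
    `|f (z + h *: v) - f z - h * L| <= C * `|h| ^+ 2) -> is_derive z v f L.
Proof.
move=> d0 H; apply/is_deriveP => e e0.
have C0 : 0 < `|C| + 1 by rewrite ltr_wpDl.
have eC : 0 < e / (`|C| + 1) by rewrite divr_gt0.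
exists (Num.min d (e / (`|C| + 1))); first by rewrite lt_min d0.
move=> h; rewrite lt_min => /andP[hd he].
apply: le_trans (H _ hd) _; rewrite expr2 mulrA ler_wpM2r//.
apply: (@le_trans _ _ ((`|C| + 1) * `|h|)).
  by rewrite ler_wpM2r// (le_trans (ler_norm C))// lerDl.
by rewrite mulrC -ler_pdivlMr// ltW.
Qed.

Lemma is_derive_line (V : normedModType R) (f : V -> R) (z v : V) (s L : R) :
  is_derive (z + s *: v) v f L -> is_derive s 1 (fun s => f (z + s *: v)) L.
Proof.
move=> /is_deriveP H; apply/is_deriveP => e e0; have [d d0 Hd] := H e e0.
exists d => // h hd.
have -> : z + (s + h *: 1) *: v = z + s *: v + h *: v.
  by rewrite (_ : h *: 1 = h) ?scalerDl ?addrA//; exact: mulr1.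
exact: Hd.
Qed.

Lemma is_derive_affine (g : R -> R) (a b s L : R) :
  is_derive (a + s * b) 1 g L -> is_derive s 1 (fun s => g (a + s * b)) (b * L).
Proof.
move=> H; have aff : is_derive s 1 (fun s => a + s * b) b.
  have -> : (fun s => a + s * b) = cst a + (b \*: id).
    by apply/funext => x /=; rewrite mulrC.
  by apply: is_derive_eq; rewrite add0r /GRing.scale/= mulr1.
have := @is_derive1_comp _ g _ s _ _ H aff.
by rewrite mulrC.
Qed.

Lemma is_derive_bigsum (I : Type) (r : seq I) (F : I -> R -> R) (dF : I -> R)
    (s : R) : (forall i, is_derive s 1 (F i) (dF i)) ->
  is_derive s 1 (fun s => \sum_(i <- r) F i s) (\sum_(i <- r) dF i).
Proof.
move=> H; elim: r => [|i r IH].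
  rewrite big_nil (_ : (fun _ => _) = cst 0); first exact: is_derive_cst.
  by apply/funext => x; rewrite big_nil.
rewrite big_cons.
have -> : (fun s => \sum_(j <- i :: r) F j s) = F i + (fun s => \sum_(j <- r) F j s).
  by apply/funext => x; rewrite big_cons.
exact: is_deriveD.
Qed.

Lemma is_derive_monomial (c s : R) k :
  is_derive s 1 (fun s => c * s ^+ k) (c * (k%:R * s ^+ k.-1)).
Proof.
have -> : (fun s => c * s ^+ k) = c \*: (id ^+ k).
  by apply/funext => x; rewrite /GRing.scale/= exprfctE.
by apply: is_derive_eq; rewrite /GRing.scale/= mulr1.
Qed.

Lemma is_derive_continuous (g : R -> R) (s L : R) :
  is_derive s 1 g L -> {for s, continuous g}.
Proof. by move=> [H _]; apply: differentiable_continuous; exact/derivable1_diffP. Qed.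

Lemma mvt01 (g dg : R -> R) :
  (forall s : R, 0 <= s -> s <= 1 -> is_derive s 1 g (dg s)) ->
  exists s : R, [/\ 0 <= s, s <= 1 & g 1 - g 0 = dg s].
Proof.
move=> H.
have [||s] := @MVT _ g dg 0 1 ltr01.
- by move=> x; rewrite in_itv/= => /andP[/ltW x0 /ltW x1]; exact: H.
- apply: continuous_in_subspaceT => x; rewrite inE/= in_itv/= => /andP[x0 x1].
  exact: is_derive_continuous (H x x0 x1).
rewrite in_itv/= => /andP[/ltW s0 /ltW s1]; rewrite subr0 mulr1 => E.
by exists s.
Qed.

Lemma mvt01_le (g dg : R -> R) (M : R) :
  (forall s : R, 0 <= s -> s <= 1 -> is_derive s 1 g (dg s)) ->
  (forall s : R, 0 <= s -> s <= 1 -> `|dg s| <= M) -> `|g 1 - g 0| <= M.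
Proof. by move=> /mvt01[s [s0 s1 ->]]; apply. Qed.

(** Parametrising by [s] in [[0, 1]] makes the order of [a] and [b] irrelevant and covers
    [a = b]. *)
Lemma mvt_segment (g dg : R -> R) (a b : R) :
  (forall s : R, 0 <= s -> s <= 1 -> is_derive (a + s * (b - a)) 1 g (dg (a + s * (b - a)))) ->
  exists s : R, [/\ 0 <= s, s <= 1 & g b - g a = (b - a) * dg (a + s * (b - a))].
Proof.
move=> H.
have [s [s0 s1]] := @mvt01 (fun s => g (a + s * (b - a)))
  (fun s => (b - a) * dg (a + s * (b - a)))
  (fun s s0 s1 => is_derive_affine (H s s0 s1)).
by rewrite mul1r mul0r addr0 [a + _]addrC subrK => E; exists s.
Qed.

Lemma continuous_bounded01 (phi : R -> R) : continuous phi ->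
  exists M : R, forall s : R, 0 <= s -> s <= 1 -> `|phi s| <= M.
Proof.
move=> cphi.
have [c _ Hc] := @EVT_max _ (fun s => `|phi s|) 0 1 ler01
  (@continuous_subspaceT _ _ _ _ (fun s => continuous_comp (cphi s) (@norm_continuous _ _ _))).
by exists `|phi c| => s s0 s1; apply: Hc; rewrite in_itv/= s0.
Qed.

Lemma antiderivative (phi : R -> R) (a b x0 : R) : continuous phi ->
  exists2 F : R -> R, F x0 = 0 & forall x, a < x < b -> is_derive x 1 F (phi x).
Proof.
move=> cphi.
pose F x := (\int[lebesgue_measure]_(t in [set` `[a, x]]) phi t)%R.
exists (F - cst (F x0)); first by rewrite /GRing.add/=/cst/= subrr.
move=> x /andP[ax xb].
have [] := @continuous_FTC1 _ phi (BLeft a) x b xb _ _ _.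
- apply: continuous_compact_integrable; first exact: segment_compact.
  exact: continuous_subspaceT.
- by rewrite /= lte_fin.
- exact: cphi.
move=> dF FE.
rewrite -[phi x]subr0; apply: is_deriveB.
by rewrite -FE derive1E; exact: derivableP.
Qed.

(** Retraction onto [[a, b]]: precomposition turns functions controlled only on a segment into
    globally continuous ones, as [antiderivative] requires. *)
Definition clamp (a b x : R) := Num.max a (Num.min b x).

Lemma clamp_in a b x : a <= b -> a <= clamp a b x <= b.
Proof. by move=> ab; rewrite /clamp le_max lexx/= ge_max ab ge_min lexx. Qed.

Lemma clamp_id a b x : a <= x <= b -> clamp a b x = x.
Proof.
by move=> /andP[ax xb]; rewrite /clamp min_r// max_r.
Qed.

Lemma continuous_clamp a b : continuous (clamp a b).
Proof.
move=> x; apply: (@continuous_max _ _ (cst a) (fun x => Num.min b x)).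
  exact: cst_continuous.
apply: (@continuous_min _ _ (cst b) id); first exact: cst_continuous.
by move=> ?; exact: cvg_id.
Qed.

End Calculus.

(** * Taylor expansion of smooth functions of several variables *)

Section Taylor.
Variables (R : realType) (n : nat).
Implicit Types (W : set 'rV[R]_n) (b : 'rV[R]_n -> R) (z q e c : 'rV[R]_n).

Definition box c (r : R) : set 'rV[R]_n :=
  [set z | forall i, `|z ord0 i - c ord0 i| <= r].

Lemma box_center c r : 0 <= r -> box c r c.
Proof. by move=> r0 i; rewrite subrr normr0. Qed.

Lemma box_convex c r q e (s : R) : box c r q -> box c r (q + e) ->
  0 <= s -> s <= 1 -> box c r (q + s *: e).
Proof.
move=> Kq Kqe s0 s1 i; have := Kq i; have := Kqe i; rewrite !mxE => A B.
have -> : q ord0 i + s * e ord0 i - c ord0 i =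
  s * (q ord0 i + e ord0 i - c ord0 i) + (1 - s) * (q ord0 i - c ord0 i) by ring.
apply: le_trans (ler_normD _ _) _; rewrite !normrM (ger0_norm s0).
rewrite (@ger0_norm _ (1 - s)) ?subr_ge0//.
have : s * `|q ord0 i + e ord0 i - c ord0 i| <= s * r by rewrite ler_wpM2l.
have : (1 - s) * `|q ord0 i - c ord0 i| <= (1 - s) * r by rewrite ler_wpM2l// subr_ge0.
lra.
Qed.

Lemma nbhs_rV z (A : set 'rV[R]_n) : nbhs z A ->
  exists2 d : R, 0 < d & forall z', (forall i, `|z' ord0 i - z ord0 i| < d) -> A z'.
Proof.
move=> /nbhs_ballP[d d0 H]; exists d => // z' Hz; apply: H; split => // i j.
by rewrite ord1 /ball/= distrC; exact: Hz.
Qed.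

Lemma rV_nbhs z (A : set 'rV[R]_n) (d : R) : 0 < d ->
  (forall z', (forall i, `|z' ord0 i - z ord0 i| < d) -> A z') -> nbhs z A.
Proof.
move=> d0 H; apply/nbhs_ballP; exists d => // z' [_ Hz]; apply: H => i.
by have := Hz ord0 i; rewrite /ball/= distrC.
Qed.

Lemma open_box W z : open W -> W z -> exists2 r : R, 0 < r & box z r `<=` W.
Proof.
move=> oW Wz; have [d d0 H] := nbhs_rV (open_nbhs_nbhs (conj oW Wz)).
exists (d / 2); first by rewrite divr_gt0.
by move=> z' Kz; apply: H => i; apply: le_lt_trans (Kz i) _; rewrite ltr_pdivrMr// ltr_pMr// ltr1n.
Qed.

Lemma box_compact c r : compact (box c r).
Proof.
have := @rV_compact R n (fun i => [set` `[c ord0 i - r, c ord0 i + r]])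
  (fun i => @segment_compact _ _ _).
congr (compact _); apply/seteqP; split => z /= H i; have := H i.
  by rewrite in_itv/= ler_distl.
by rewrite in_itv/= ler_distl.
Qed.

Lemma continuous_bounded_box c r b : (forall z, box c r z -> {for z, continuous b}) ->
  exists2 M : R, 0 <= M & forall z, box c r z -> `|b z| <= M.
Proof.
move=> cb; have [r0|r0] := ltP r 0; last first.
  have [| |m _ Hm] := @compact_EVT_max _ R (fun z => `|b z|) (box c r) _ (@box_compact c r).
  - by exists c; exact: box_center.
  - apply: continuous_in_subspaceT => z; rewrite inE => Kz.
    by apply: continuous_comp; [exact: cb|exact: norm_continuous].
  by exists `|b m| => // z Kz; apply: Hm; rewrite inE.
(* For [r < 0] the box is empty unless [n = 0], when the space is a single point. *)
have [[i _]|n0] := pselect (exists i : 'I_n, True); last first.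
  exists `|b c| => // z _; suff -> : z = c by [].
  by apply/rowP => i; case: n0; exists i.
by exists 0 => // z /(_ i) H; have := le_lt_trans H r0; rewrite normr_lt0.
Qed.

Lemma Cinf_partial W b i : Cinf_on W b -> Cinf_on W (partial b i).
Proof.
move=> Wb s; have := Wb (rcons s i).
by rewrite /iter_partial foldr_rcons.
Qed.

Lemma Cinf_continuous W b z : Cinf_on W b -> W z -> {for z, continuous b}.
Proof. by move=> Wb /(Wb [::])[]. Qed.

Lemma Cinf_is_derive W b z i : Cinf_on W b -> W z ->
  is_derive z (delta_mx 0 i) b (partial b i z).
Proof. by move=> Wb /(Wb [::])[_ /(_ i)]; exact: derivableP. Qed.

Lemma Cinf_subset W W' b : W' `<=` W -> Cinf_on W b -> Cinf_on W' b.
Proof. by move=> WW Wb s z /WW; exact: Wb. Qed.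

(** [Cinf_on] provides derivatives along basis vectors only. The displacement is performed one
    coordinate at a time; the mean value theorem turns each leg into a partial derivative at a point
    near [z], and continuity compares it with the value at [z]. *)
Lemma Cinf_is_derive_dir W b z v : open W -> Cinf_on W b -> W z ->
  is_derive z v b (\sum_i v ord0 i * partial b i z).
Proof.
move=> oW Wb Wz; apply/is_deriveP => e e0.
pose M := \sum_i `|v ord0 i| + 1.
have M0 : 0 < M by rewrite ltr_wpDl// sumr_ge0.
have eM : 0 < e / M by rewrite divr_gt0.
have vM i : `|v ord0 i| <= M.
  rewrite /M (bigD1 i)//= -addrA lerDl addr_ge0// sumr_ge0//.
have [d d0 Hd] : exists2 d : R, 0 < d & forall z', (forall i, `|z' ord0 i - z ord0 i| < d) ->
    W z' /\ forall k, `|partial b k z' - partial b k z| <= e / M.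
  apply: (@nbhs_rV z (W `&` [set z' | forall k, `|partial b k z' - partial b k z| <= e / M])).
  apply: filterI; first exact: open_nbhs_nbhs.
  apply: (@filter_forall _ _ (fun k => [set z' | `|partial b k z' - partial b k z| <= e / M]) (nbhs z) _) => k.
  have /cvgrPdist_le /(_ _ eM) := Cinf_continuous (@Cinf_partial _ _ k Wb) Wz.
  by apply: filterS => z'; rewrite distrC.
exists (d / M); first by rewrite divr_gt0.
move=> h hd.
have hM : `|h| * M < d by rewrite -ltr_pdivlMr.
(* Corner [k] of the broken path: the first [k] coordinates have already moved. *)
pose P (k : nat) : 'rV[R]_n := z + \row_j (if (j < k)%N then h * v ord0 j else 0).
have PS (k : 'I_n) : P k.+1 = P k + (h * v ord0 k) *: delta_mx 0 k.
  apply/rowP => j; rewrite !mxE ltnS eqxx/= -addrA; congr (_ + _).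
  have [->|jk] := eqVneq j k; first by rewrite leqnn ltnn mulr1 add0r.
  by rewrite mulr0 addr0 leq_eqVlt -val_eqE in jk *; rewrite (negbTE jk).
have Pn : P n = z + h *: v.
  by congr (_ + _); apply/rowP => j; rewrite !mxE ltn_ord.
have P0 : P 0%N = z by rewrite -[RHS]addr0; congr (_ + _); apply/rowP => j; rewrite !mxE.
have step (k : 'I_n) : `|b (P k.+1) - b (P k) - h * v ord0 k * partial b k z|
    <= `|h| * `|v ord0 k| * (e / M).
  pose g s := b (P k + s *: delta_mx 0 k).
  have near_z (s : R) : 0 <= s -> s <= 1 -> W (P k + (0 + s * (h * v ord0 k - 0)) *: delta_mx 0 k) /\
      `|partial b k (P k + (0 + s * (h * v ord0 k - 0)) *: delta_mx 0 k) - partial b k z| <= e / M.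
    move=> s0 s1.
    suff H : W (P k + (0 + s * (h * v ord0 k - 0)) *: delta_mx 0 k) /\ forall k',
      `|partial b k' (P k + (0 + s * (h * v ord0 k - 0)) *: delta_mx 0 k) - partial b k' z| <= e / M.
      by case: H.
    apply: Hd => i; rewrite !mxE add0r subr0 eqxx/=.
    have hv : `|h * v ord0 i| < d.
      by apply: le_lt_trans hM; rewrite normrM ler_wpM2l.
    have [ik|ik] := eqVneq i k.
      rewrite -ik ltnn addr0 mulr1 addrAC subrr add0r normrM (ger0_norm s0).
      by apply: le_lt_trans hv; rewrite ler_piMl.
    by rewrite mulr0 addr0 addrAC subrr add0r; case: ifP => _ //; rewrite normr0.
  have [s [s0 s1]] := @mvt_segment R g (fun s => partial b k (P k + s *: delta_mx 0 k)) 0 (h * v ord0 k)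
    (fun s s0 s1 => is_derive_line (Cinf_is_derive k Wb (near_z s s0 s1).1)).
  rewrite /g scale0r addr0 -PS => ->; rewrite subr0 -mulrBr normrM normrM.
  rewrite ler_wpM2l ?mulr_ge0//.
  by have [_] := near_z s s0 s1; rewrite !subr0.
have bz : b z = b (P 0%N) by rewrite P0.
rewrite -Pn bz.
have -> : b (P n) - b (P 0%N) = \sum_(k < n) (b (P k.+1) - b (P k)).
  by rewrite -(big_mkord xpredT (fun k => b (P k.+1) - b (P k))) telescope_sumr.
rewrite mulr_sumr -sumrB.
apply: le_trans (ler_norm_sum _ _ _) _.
apply: (@le_trans _ _ (\sum_(k < n) `|h| * `|v ord0 k| * (e / M))).
  by apply: ler_sum => k _; rewrite mulrA; exact: step.
rewrite -mulr_suml -mulr_sumr mulrC mulrA mulrAC ler_wpM2r//.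
rewrite mulrAC ler_pdivrMr// ler_pM2l// /M lerDl//.
Qed.

(** The [k]-th derivative along [e], homogeneous of degree [k] in [e]. The recursion replaces [b] by
    its partial derivatives, so inductions on [k] generalise over [b]. *)
Fixpoint dirD (k : nat) e b : 'rV[R]_n -> R :=
  if k is k'.+1 then fun z => \sum_i e ord0 i * dirD k' e (partial b i) z else b.

Lemma dirDZ k (s : R) e b z : dirD k (s *: e) b z = s ^+ k * dirD k e b z.
Proof.
elim: k b => [|k IH] b /=; first by rewrite expr0 mul1r.
rewrite mulr_sumr; apply: eq_bigr => i _; rewrite IH mxE exprS; ring.
Qed.

(** Order [N] means degree below [N]; at [N = 0] the remainder is [b] itself, and its estimate is
    boundedness. *)
Definition taylor (N : nat) e b q : R := \sum_(k < N) dirD k e b q / k`!%:R.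

Lemma taylorS (N : nat) (s : R) e b q :
  is_derive s 1 (fun s => taylor N.+1 (s *: e) b q)
    (\sum_i e ord0 i * taylor N (s *: e) (partial b i) q).
Proof.
have -> : (fun s => taylor N.+1 (s *: e) b q) =
    (fun s => \sum_(k < N.+1) dirD k e b q / k`!%:R * s ^+ k).
  by apply/funext => x; apply: eq_bigr => k _; rewrite dirDZ; ring.
apply: is_derive_eq; first exact: (is_derive_bigsum _ (fun k : 'I_N.+1 => is_derive_monomial _ s k)).
rewrite big_ord_recl /= !mul0r mulr0 add0r.
rewrite /taylor.
under [RHS]eq_bigr do rewrite mulr_sumr.
rewrite exchange_big/=; apply: eq_bigr => k _.
rewrite /bump leq0n add1n /= factS natrM !mulr_suml; apply: eq_bigr => i _.
rewrite dirDZ.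
have : k.+1%:R != 0 :> R by rewrite pnatr_eq0.
have : (k`!)%:R != 0 :> R by rewrite pnatr_eq0 -lt0n fact_gt0.
move: (k.+1%:R) => x y0 x0; field.
by rewrite x0 y0.
Qed.

(** The remainder along [q + s *: e] vanishes at [s = 0] if the order is positive, and by [taylorS]
    its derivative in [s] combines, with coefficients [e_i], the remainders of the partial
    derivatives at the order below; each order gains a factor [rho]. One constant serves all base
    points of the box. *)
Lemma taylor_bound W c r b (N : nat) : open W -> box c r `<=` W -> Cinf_on W b ->
  exists2 C : R, 0 <= C & forall q e (rho : R), box c r q -> box c r (q + e) ->
    (forall i, `|e ord0 i| <= rho) -> 0 <= rho ->
    `|b (q + e) - taylor N e b q| <= C * rho ^+ N.
Proof.
move=> oW KW; elim: N b => [|N IH] b Wb.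
  have [C C0 HC] := @continuous_bounded_box c r b (fun z Kz => Cinf_continuous Wb (KW _ Kz)).
  exists C => // q e rho Kq Kqe _ _.
  by rewrite /taylor big_ord0 subr0 expr0 mulr1; exact: HC.
have {IH} IH i : exists C : R, 0 <= C /\ forall q e (rho : R), box c r q -> box c r (q + e) ->
    (forall i, `|e ord0 i| <= rho) -> 0 <= rho ->
    `|partial b i (q + e) - taylor N e (partial b i) q| <= C * rho ^+ N.
  by have [C C0 HC] := IH _ (@Cinf_partial _ _ i Wb); exists C.
have [C HC] := choice _ IH.
exists (\sum_i C i); first by apply: sumr_ge0 => i _; case: (HC i).
move=> q e rho Kq Kqe er rho0.
pose g s := b (q + s *: e) - taylor N.+1 (s *: e) b q.
have -> : b (q + e) - taylor N.+1 e b q = g 1 - g 0.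
  rewrite /g !scale1r scale0r addr0; rewrite [X in _ = _ - X](_ : _ = 0) ?subr0//.
  rewrite /taylor big_ord_recl/= big1 ?addr0; first by rewrite fact0 divr1 subrr.
  move=> k _; rewrite /bump leq0n add1n/= big1 ?mul0r// => i _.
  by rewrite mxE mul0r.
pose dg s := \sum_i e ord0 i * (partial b i (q + s *: e) - taylor N (s *: e) (partial b i) q).
apply: (@mvt01_le _ g dg) => s s0 s1.
  have Ks := box_convex Kq Kqe s0 s1.
  have -> : dg s = \sum_i e ord0 i * partial b i (q + s *: e) -
      \sum_i e ord0 i * taylor N (s *: e) (partial b i) q.
    by rewrite -sumrB; apply: eq_bigr => i _; rewrite mulrBr.
  apply: is_deriveB; last exact: taylorS.
  apply: is_derive_line; exact: Cinf_is_derive_dir oW Wb (KW _ Ks).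
rewrite /dg; apply: le_trans (ler_norm_sum _ _ _) _.
rewrite mulr_suml; apply: ler_sum => i _; rewrite normrM exprS mulrCA.
apply: ler_pM => //; have [_] := HC i; apply => //; first exact: box_convex.
move=> j; rewrite mxE normrM (ger0_norm s0).
by apply: le_trans (er j); rewrite ler_piMl.
Qed.

End Taylor.

(** * Primitives depending smoothly on parameters *)

Lemma segment_ball_lt (R : realFieldType) (a r x y s : R) :
  `|x - a| < r -> `|y - a| < r -> 0 <= s -> s <= 1 -> `|x + s * (y - x) - a| < r.
Proof.
rewrite !ltr_distl => /andP[x1 x2] /andP[y1 y2] s0 s1.
have [s2|s2] := leP s (1/2); apply/andP; split; nra.
Qed.

Section ParametricPrimitive.
Variables (R : realType) (n : nat) (W : set 'rV[R]_n) (c : 'rV[R]_n) (r : R) (k : 'I_n).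
Hypotheses (oW : open W) (r0 : 0 < r) (KW : box c r `<=` W).
Implicit Types (z : 'rV[R]_n) (A B g : 'rV[R]_n -> R) (s t h : R).

(** Open, because the fundamental theorem of calculus is applied only inside the interval of
    integration. *)
Definition obox : set 'rV[R]_n := [set z | forall i, `|z ord0 i - c ord0 i| < r].

Lemma obox_sub : obox `<=` box c r.
Proof. by move=> z Oz i; exact: ltW. Qed.

Lemma obox_open z : obox z -> nbhs z obox.
Proof.
move=> Oz.
have [M M1 HM] : exists2 M : R, M < r & forall i, `|z ord0 i - c ord0 i| <= M.
  have [z'|] := pselect (exists i : 'I_n, True); last first.
    by move=> H; exists 0 => // i; case: H; exists i.
  case: z' => i0 _.
  pose j := [arg max_(i > i0) `|z ord0 i - c ord0 i|]%O.
  exists `|z ord0 j - c ord0 j|; first exact: Oz.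
  by move=> i; rewrite /j; case: arg_maxP => //= j' _ /(_ i isT).
apply: (@rV_nbhs _ _ _ _ (r - M)); first by rewrite subr_gt0.
move=> z' Hz i; have := Hz i; have := HM i => A B.
have -> : z' ord0 i - c ord0 i = (z' ord0 i - z ord0 i) + (z ord0 i - c ord0 i) by ring.
by apply: le_lt_trans (ler_normD _ _) _; lra.
Qed.

Definition setk z s : 'rV[R]_n := \row_j if j == k then s else z ord0 j.

Lemma setk_id z : setk z (z ord0 k) = z.
Proof. by apply/rowP => j; rewrite mxE; case: eqP => [->|]. Qed.

Lemma setkK z s t : setk (setk z s) t = setk z t.
Proof. by apply/rowP => j; rewrite !mxE; case: eqP. Qed.

Lemma setk_line z s : setk z s = setk z 0 + s *: delta_mx 0 k.
Proof.
by apply/rowP => j; rewrite !mxE/=; case: eqP => _; rewrite ?mulr1 ?mulr0 ?add0r ?addr0.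
Qed.

Lemma setk_other z s h i : i != k ->
  setk z s + h *: delta_mx 0 i = setk (z + h *: delta_mx 0 i) s.
Proof.
move=> ik; apply/rowP => j; rewrite !mxE/=; case: eqP => [->|//].
by rewrite eq_sym (negbTE ik) mulr0 addr0.
Qed.

Lemma setk_obox z s : obox z -> `|s - c ord0 k| < r -> obox (setk z s).
Proof. by move=> Oz sr i; rewrite mxE; case: eqP => [->|]. Qed.

Lemma obox_segment z s : obox z -> 0 <= s -> s <= 1 ->
  obox (setk z (c ord0 k + s * (z ord0 k - c ord0 k))).
Proof.
move=> Oz s0 s1; apply: setk_obox => //.
rewrite addrAC subrr add0r normrM (ger0_norm s0).
by apply: le_lt_trans (Oz k); rewrite ler_piMl.
Qed.

(** Vanishing on the hyperplane through [c] gives the initial value for the mean value arguments on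
    [A]. *)
Definition primitive_k g A := forall z, obox z ->
  A (setk z (c ord0 k)) = 0 /\ is_derive z (delta_mx 0 k) A (g z).

Lemma primitive_exists g : Cinf_on W g -> exists A, primitive_k g A.
Proof.
move=> Wg; pose v := c ord0 k.
have vr : v - r <= v + r by rewrite lerD2l ge0_cp ?ltW.
have H z : exists F : R -> R, obox z -> F v = 0 /\
    forall s, `|s - v| < r -> is_derive s 1 F (g (setk z s)).
  have [Oz|nOz] := pselect (obox z); last by exists (fun=> 0).
  pose phi s := g (setk z (clamp (v - r) (v + r) s)).
  have cphi : continuous phi.
    move=> s; have /andP[s1 s2] := clamp_in s vr.
    have Ws : W (setk z (clamp (v - r) (v + r) s)).
      apply: KW => i; rewrite mxE; case: eqP => [->|_]; last exact: ltW.
      by rewrite ler_distl s1.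
    apply: (@continuous_comp _ _ _ (clamp (v - r) (v + r)) (fun s => g (setk z s))).
      exact: continuous_clamp.
    apply: (@is_derive_continuous _ _ _ (partial g k (setk z (clamp (v - r) (v + r) s)))).
    have -> : (fun s => g (setk z s)) = (fun s => g (setk z 0 + s *: delta_mx 0 k)).
      by apply/funext => x; rewrite -setk_line.
    by apply: is_derive_line; rewrite -setk_line; exact: Cinf_is_derive Wg Ws.
  have [F F0 HF] := antiderivative (v - r) (v + r) v cphi.
  exists F => _; split => // s; rewrite ltr_distl => svr.
  have := HF s svr; rewrite /phi clamp_id//.
  by case/andP: svr => /ltW -> /ltW ->.
have [F HF] := choice _ H.
(* The choice is made at the foot [setk z v], so all points of a line in direction [k] share one
   primitive. *)
exists (fun z => F (setk z v) (z ord0 k)) => z Oz.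
have Ov : obox (setk z v) by apply: setk_obox; rewrite // subrr normr0.
have [F0 dF] := HF _ Ov; split; first by rewrite setkK mxE eqxx.
have := dF _ (Oz k); rewrite setkK setk_id => /is_deriveP D.
apply/is_deriveP => e e0; have [d d0 Hd] := D e e0.
exists d => // h hd; have := Hd h hd.
rewrite (_ : h *: 1 = h); last exact: mulr1.
have -> : setk (z + h *: delta_mx 0 k) v = setk z v.
  by apply/rowP => j; rewrite !mxE/=; case: eqP => // _; rewrite mulr0 addr0.
by rewrite !mxE !eqxx mulr1.
Qed.

Lemma primitive_eq g A B : (forall z, obox z -> A z = B z) ->
  primitive_k g A -> primitive_k g B.
Proof.
move=> AB PA z Oz; have [A0 dA] := PA z Oz; split.
  by rewrite -AB//; apply: setk_obox; rewrite // subrr normr0.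
apply: near_eq_is_derive dA; near=> y; apply: AB; near: y; exact: obox_open.
Unshelve. all: by end_near. Qed.

Lemma is_derive_setk g A z s : primitive_k g A -> obox (setk z s) ->
  is_derive s 1 (fun s => A (setk z s)) (g (setk z s)).
Proof.
move=> PA Oz; have [_] := PA _ Oz; rewrite setk_line => /is_derive_line.
by congr (is_derive _ _ _ _); apply/funext => x; rewrite -setk_line.
Qed.

(** Differentiation under the integral sign by the mean value theorem: [E] vanishes at the foot and
    its derivative is the order 2 Taylor remainder of [g] in direction [i], so [E] is at most
    [r * C * h ^ 2] in absolute value. *)
Lemma primitive_partial g A B i z : Cinf_on W g -> primitive_k g A ->
  i != k -> primitive_k (partial g i) B -> obox z -> is_derive z (delta_mx 0 i) A (B z).
Proof.
move=> Wg PA ik PB Oz.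
have [C C0 HC] := taylor_bound 2 oW KW Wg.
have [d d0 Hd] := nbhs_rV (obox_open Oz).
have Oh h : `|h| < d -> obox (z + h *: delta_mx 0 i).
  move=> hd; apply: Hd => j; rewrite !mxE/= addrAC subrr add0r.
  by case: eqP => _; rewrite ?mulr1 ?mulr0 ?normr0.
apply: (@is_derive_quad _ _ _ _ _ _ (r * C) d) => // h hd.
pose E s := A (setk z s + h *: delta_mx 0 i) - A (setk z s) - h * B (setk z s).
pose dE s := g (setk z s + h *: delta_mx 0 i) - g (setk z s) - h * partial g i (setk z s).
have Ovz : obox (setk z (c ord0 k)) by apply: setk_obox; rewrite // subrr normr0.
have Ovh : obox (setk (z + h *: delta_mx 0 i) (c ord0 k)).
  by apply: setk_obox; [exact: Oh|rewrite subrr normr0].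
have E0 : E (c ord0 k) = 0.
  rewrite /E setk_other// (PA _ (Oh _ hd)).1 (PA _ Oz).1 (PB _ Oz).1.
  by rewrite mulr0 !subr0.
have zhk : (z + h *: delta_mx 0 i) ord0 k = z ord0 k.
  by rewrite !mxE/= eq_sym (negbTE ik) mulr0 addr0.
have [s [s0 s1]] : exists s : R, [/\ 0 <= s, s <= 1 & E (z ord0 k) - E (c ord0 k) =
    (z ord0 k - c ord0 k) * dE (c ord0 k + s * (z ord0 k - c ord0 k))].
  apply: mvt_segment => s s0 s1.
  have O1 := obox_segment Oz s0 s1.
  have := obox_segment (Oh _ hd) s0 s1; rewrite zhk => O2.
  have D1 := is_derive_setk PA O1; have D3 := is_derive_setk PB O1.
  have D2 := is_derive_setk PA O2.
  have -> : E = (fun s => A (setk (z + h *: delta_mx 0 i) s)) - (fun s => A (setk z s))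
      - (h \*: (fun s => B (setk z s))).
    by apply/funext => x; rewrite /E setk_other.
  rewrite /dE setk_other//; exact: is_deriveB.
rewrite E0 subr0 /E setk_id => ->.
rewrite normrM -mulrA; apply: ler_pM => //; first exact: ltW.
rewrite /dE; set zs := setk z _.
have O1 : obox zs by exact: obox_segment.
have := obox_segment (Oh _ hd) s0 s1; rewrite zhk -setk_other// -/zs => O2.
have := HC zs (h *: delta_mx 0 i) `|h| (obox_sub O1) (obox_sub O2) _ (normr_ge0 _).
rewrite /taylor !big_ord_recl big_ord0/= fact0 divr1 addr0 divr1.
rewrite (bigD1 i)//= big1 ?addr0; last first.
  by move=> j ji; rewrite !mxE/= (negbTE ji) mulr0 mul0r.
rewrite !mxE !eqxx mulr1 opprD addrA; apply.
by move=> j; rewrite !mxE/=; case: eqP => _; rewrite ?mulr1 ?mulr0 ?normr0.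
Qed.

(** Partial derivatives alone do not give continuity. From [z'] to [zs], which share coordinate [k],
    a Lipschitz bound on [g] is carried over to [A]; from [zs] to [z], along direction [k], a bound
    on [g] suffices. *)
Lemma primitive_continuous g A z : Cinf_on W g -> primitive_k g A -> obox z ->
  {for z, continuous A}.
Proof.
move=> Wg PA Oz.
have [C C0 HC] := taylor_bound 1 oW KW Wg.
have [M M0 HM] := @continuous_bounded_box _ _ c r g (fun z Kz => Cinf_continuous Wg (KW Kz)).
have [d d0 Hd] := nbhs_rV (obox_open Oz).
apply/(@cvgrPdist_le _ _ _ (nbhs z) _) => e e0.
pose D := r * C + M + 1.
have D0 : 0 < D by rewrite ltr_wpDl// addr_ge0// mulr_ge0// ltW.
have eD : 0 < e / D by rewrite divr_gt0.
pose rho := Num.min d (e / D).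
have rho0 : 0 < rho by rewrite lt_min d0.
apply: (@rV_nbhs _ _ _ _ rho) => // z' Hz /=.
have {Hd} Oz' : obox z' by apply: Hd => i; apply: lt_le_trans (Hz i) _; rewrite ge_min lexx.
have rhoe : rho * D <= e by rewrite -ler_pdivlMr// ge_min lexx orbT.
pose zs := setk z (z' ord0 k).
have Ozs : obox zs by apply: setk_obox => //; exact: Oz'.
have H1 : `|A z' - A zs| <= r * (C * rho).
  pose E s := A (setk z' s) - A (setk z s).
  have E0 : E (c ord0 k) = 0 by rewrite /E (PA _ Oz).1 (PA _ Oz').1 subrr.
  pose dE s := g (setk z' s) - g (setk z s).
  have zsk : zs ord0 k = z' ord0 k by rewrite mxE eqxx.
  have O2 s : 0 <= s -> s <= 1 -> obox (setk z (c ord0 k + s * (z' ord0 k - c ord0 k))).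
    by move=> s0 s1; have := obox_segment Ozs s0 s1; rewrite zsk setkK.
  have [s [s0 s1]] : exists s : R, [/\ 0 <= s, s <= 1 & E (z' ord0 k) - E (c ord0 k) =
      (z' ord0 k - c ord0 k) * dE (c ord0 k + s * (z' ord0 k - c ord0 k))].
    apply: mvt_segment => s s0 s1.
    by apply: is_deriveB; apply: (is_derive_setk PA); [exact: obox_segment|exact: O2].
  rewrite E0 subr0 /E setk_id => ->.
  rewrite normrM; apply: ler_pM => //; first exact/ltW/Oz'.
  rewrite /dE; set s' := (X in setk _ X).
  have O3 : obox (setk z' s') by exact: obox_segment.
  have := HC (setk z s') (setk z' s' - setk z s') rho (obox_sub (O2 _ s0 s1)).
  rewrite addrC subrK /taylor big_ord1/= fact0 divr1 expr1; apply => //.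
  - exact: obox_sub.
  - by move=> j; rewrite !mxE; case: eqP => _; rewrite ?subrr ?normr0 ltW.
  - exact: ltW.
have H2 : `|A zs - A z| <= M * rho.
  have [s [s0 s1]] : exists s : R, [/\ 0 <= s, s <= 1 & A (setk z (z' ord0 k)) - A (setk z (z ord0 k)) =
      (z' ord0 k - z ord0 k) * g (setk z (z ord0 k + s * (z' ord0 k - z ord0 k)))].
    apply: (@mvt_segment _ (fun s => A (setk z s)) (fun s => g (setk z s))) => s s0 s1.
    apply: (is_derive_setk PA); apply: setk_obox => //.
    exact: segment_ball_lt.
  rewrite setk_id -/zs => ->; rewrite normrM mulrC; apply: ler_pM => //; last exact/ltW/Hz.
  apply/HM/obox_sub/setk_obox => //.
  exact: segment_ball_lt.
rewrite distrC; have -> : A z' - A z = (A z' - A zs) + (A zs - A z) by ring.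
apply: le_trans (ler_normD _ _) _; apply: le_trans (lerD H1 H2) _.
apply: le_trans rhoe; rewrite /D.
have -> : rho * (r * C + M + 1) = r * (C * rho) + M * rho + rho by ring.
by rewrite lerDl ltW.
Qed.

(** A class stable under partial derivatives: a primitive differentiated in direction [k] becomes
    smooth, and in another direction stays the primitive of a smooth function. Smoothness thus
    reduces to first-order regularity of the class. *)
Definition primitive_class g := exists2 b, Cinf_on W b &
  (forall z, obox z -> g z = b z) \/ primitive_k b g.

Lemma primitive_class_regular g z : primitive_class g -> obox z ->
  {for z, continuous g} /\ forall i, derivable g z (delta_mx 0 i).
Proof.
move=> [b Wb [gb|Pg]] Oz.
  have near_gb : \forall y \near z, b y = g y.
    by near=> y; rewrite gb//; near: y; exact: obox_open.
  split; last first.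
    move=> i; have [] // := near_eq_is_derive near_gb (Cinf_is_derive i Wb (KW (obox_sub Oz))).
  rewrite /prop_for /continuous_at -(nbhs_singleton near_gb).
  apply: cvg_trans (Cinf_continuous Wb (KW (obox_sub Oz))).
  exact: (@near_eq_cvg _ _ (nbhs z) _ b g near_gb).
split; first exact: primitive_continuous Wb Pg Oz.
move=> i; have [->|ik] := eqVneq i k; first by case: (Pg z Oz).2.
have [B PB] := primitive_exists (Cinf_partial i Wb).
by case: (primitive_partial Wb Pg ik PB Oz).
Unshelve. all: by end_near. Qed.

Lemma primitive_class_partial g i : primitive_class g -> primitive_class (partial g i).
Proof.
move=> [b Wb [gb|Pg]].
  exists (partial b i); [exact: Cinf_partial|left => z Oz].
  have near_gb : \forall y \near z, b y = g y.
    by near=> y; rewrite gb//; near: y; exact: obox_open.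
  by have [_ D] := near_eq_is_derive near_gb (Cinf_is_derive i Wb (KW (obox_sub Oz))); exact: D.
have [->|ik] := eqVneq i k.
  by exists b => //; left => z Oz; case: (Pg z Oz).2.
have [B PB] := primitive_exists (Cinf_partial i Wb).
exists (partial b i); [exact: Cinf_partial|right].
apply: (primitive_eq _ PB) => z Oz.
by case: (primitive_partial Wb Pg ik PB Oz).
Unshelve. all: by end_near. Qed.

Lemma parametric_primitive b : Cinf_on W b -> exists2 A,
  Cinf_on obox A & forall z, obox z -> partial A k z = b z.
Proof.
move=> Wb; have [A PA] := primitive_exists Wb.
exists A; last by move=> z Oz; case: (PA z Oz).2.
move=> s z Oz; apply: primitive_class_regular Oz.
elim: s => [|i s IH] /=; first by exists b => //; right.
exact: primitive_class_partial.
Qed.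

End ParametricPrimitive.

(** * Separation of variables along segments *)

Section SmoothGerms.
Variable R : realType.

Lemma holder0_le (h h' : R -> R) : (forall t, 0 <= t -> `|h' t| <= `|h t|) ->
  holder0 h -> holder0 h'.
Proof.
move=> hh' [c [C [c0 C0 H]]]; exists c, C; split => //.
by apply: ev0W H => t t0; apply: le_trans; exact: hh'.
Qed.

Lemma holder0_sum_norm (I : Type) (s : seq I) (F : I -> R -> R) :
  (forall i, holder0 (F i)) -> holder0 (fun t => \sum_(i <- s) `|F i t|).
Proof.
move=> HF; elim: s => [|i s IH].
  by apply: little_o_holder0; apply: little_o_eq (@little_o0 R) => t _; rewrite big_nil.
have Hi : holder0 (fun t => `|F i t|) by apply: holder0_le (HF i) => t _; rewrite normr_id.
have := holder0D Hi IH; congr (holder0 _).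
by apply/funext => t; rewrite big_cons.
Qed.

Lemma little_o_sum_norm (I : Type) (s : seq I) (F : I -> R -> R) :
  (forall i, little_o (F i)) -> little_o (fun t => \sum_(i <- s) `|F i t|).
Proof.
by move=> HF; apply: little_o_sum => i; apply: little_oW (HF i) => t _; rewrite normr_id.
Qed.

Lemma ler_bigsum_norm n (F : 'I_n -> R) i : `|F i| <= \sum_j `|F j|.
Proof. by rewrite (bigD1 i)//= lerDl sumr_ge0. Qed.

(** * Smooth functions along families of germs *)

Section Family.
Variables (n : nat) (W : set 'rV[R]_n) (b : 'rV[R]_n -> R).
Hypotheses (oW : open W) (Wb : Cinf_on W b).

(** The bound [h] does not depend on [th], so one order and one range of [t] serve the whole family.
    The margin [r - r1] keeps the moved points in the box. *)
Lemma taylor_family (T : Type) (q : T -> R -> 'rV[R]_n) (h : R -> R) c (r r1 : R) :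
  box c r `<=` W -> r1 < r -> (forall th, box c r1 (q th 0)) -> holder0 h ->
  ev0 (fun t => forall th i, `|q th t ord0 i - q th 0 ord0 i| <= h t) ->
  exists N, forall e : R, 0 < e -> ev0 (fun t => forall th,
    `|b (q th t) - taylor N (q th t - q th 0) b (q th 0)| <= e * t).
Proof.
move=> KW r1r q0 hh qh.
have hsmall : ev0 (fun t => `|h t| < r - r1) by apply: holder0_small; rewrite ?subr_gt0.
case: hh => k [C [k0 C0 hC]].
have [N HN] := powR_pow_small k0 C0; exists N => e e0.
have [M M0 HM] := taylor_bound N oW KW Wb.
have := little_oZ M HN => /(_ e e0) HN'.
apply: ev0W (ev0I (ev0I qh hC) (ev0I hsmall HN')) => t t0 [[A B] [D E]] th.
have qq : q th t = q th 0 + (q th t - q th 0) by rewrite addrC subrK.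
have K0 : box c r (q th 0) by move=> i; apply: le_trans (q0 th i) _; exact: ltW.
have Kt : box c r (q th t).
  move=> i; have := A th i; have := q0 th i; have := ler_norm (h t).
  have -> : q th t ord0 i - c ord0 i =
    (q th t ord0 i - q th 0 ord0 i) + (q th 0 ord0 i - c ord0 i) by ring.
  move=> h1 h2 h3; apply: le_trans (ler_normD _ _) _.
  by move: D; lra.
rewrite {1}qq; apply: le_trans (HM _ _ (C * t `^ k) K0 _ _ _) _ => //.
- by rewrite -qq.
- move=> i; rewrite !mxE; apply: le_trans (A th i) _.
  exact: le_trans (ler_norm _) B.
- by rewrite mulr_ge0// powR_ge0.
- exact: le_trans (ler_norm _) E.
Qed.

Lemma Ro_dirD k (e : R -> 'rV[R]_n) (g : 'rV[R]_n -> R) z :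
  (forall i, Ro (fun t => e t ord0 i)) -> Ro (fun t => dirD k (e t) g z).
Proof.
move=> He; elim: k g => [|k IH] g /=; first exact: Ro_cst.
by apply: Ro_sum => i; apply: RoM.
Qed.

Lemma Ro_taylor N (e : R -> 'rV[R]_n) z :
  (forall i, Ro (fun t => e t ord0 i)) -> Ro (fun t => taylor N (e t) b z).
Proof.
move=> He; apply: Ro_sum => k; apply: RoM; first exact: Ro_dirD.
exact: Ro_cst.
Qed.

(** A Taylor polynomial in elements of [Ro] is in [Ro], and [b (x t)] differs from it by [o(t)]. *)
Lemma Ro_smooth (x : R -> 'rV[R]_n) : (forall i, Ro (fun t => x t ord0 i)) ->
  W (x 0) -> Ro (fun t => b (x t)).
Proof.
move=> Rx Wx; have [r r0 KW] := open_box oW Wx.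
have [||||N HN] := @taylor_family unit (fun=> x)
    (fun t => \sum_i `|x t ord0 i - x 0 ord0 i|) _ r 0 KW.
- by [].
- by move=> _; exact: box_center.
- by apply: holder0_sum_norm => i; exact: Ro_holder0.
- apply: ev0T => t _ _ i; exact: (ler_bigsum_norm (fun i => x t ord0 i - x 0 ord0 i)).
apply: (@Ro_fequiv _ (fun t => taylor N (x t - x 0) b (x 0))).
  apply: Ro_taylor => i; have := RoD (Rx i) (Ro_cst (- x 0 ord0 i)).
  by congr (Ro _); apply/funext => t; rewrite !mxE.
by apply: fequiv_sym => e e0; apply: ev0W (HN e e0) => t _ /(_ tt).
Qed.

Lemma smooth_fequiv (x y : R -> 'rV[R]_n) : (forall i, Ro (fun t => x t ord0 i)) ->
  W (x 0) -> (forall i, fequiv (fun t => x t ord0 i) (fun t => y t ord0 i)) ->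
  fequiv (fun t => b (x t)) (fun t => b (y t)).
Proof.
move=> Rx Wx xy; have [r r0 KW] := open_box oW Wx.
have [M M0 HM] := taylor_bound 1 oW KW Wb.
have xK : ev0 (fun t => forall i, `|x t ord0 i - x 0 ord0 i| < r).
  by apply: ev0_forall => i; apply: holder0_small => //; exact: (Ro_holder0 (Rx i)).
have yK : ev0 (fun t => forall i, `|y t ord0 i - x 0 ord0 i| < r).
  apply: ev0_forall => i; apply: holder0_small => //.
  have := Ro_holder0 (Ro_fequiv (Rx i) (xy i)).
  by rewrite (fequiv0 (xy i)).
apply: fequiv_sym => e e0.
have := little_oZ M (little_o_sum_norm (index_enum 'I_n) (fun i => fequiv_sym (xy i))) => /(_ e e0).
move=> H; apply: ev0W (ev0I (ev0I xK yK) H) => t t0 [[A B] E].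
have qq : y t = x t + (y t - x t) by rewrite addrC subrK.
have {HM} := HM (x t) (y t - x t) (\sum_i `|y t ord0 i - x t ord0 i|).
rewrite -qq /taylor big_ord1/= fact0 divr1 expr1 => HM.
apply: le_trans (HM _ _ _ _) _.
- by move=> i; exact: ltW.
- by move=> i; exact: ltW.
- move=> i; rewrite !mxE; exact: (ler_bigsum_norm (fun i => y t ord0 i - x t ord0 i)).
- exact: sumr_ge0.
- exact: le_trans (ler_norm _) E.
Qed.

End Family.

(** Nothing is asked of the weights [w j], not even boundedness: elimination treats them as
    unknowns. *)
Definition approximable (G : R -> R -> R) :=
  exists (J : finType) (w phi : J -> R -> R), (forall j, continuous (phi j)) /\
    forall e : R, 0 < e -> ev0 (fun t => forall th : R, 0 <= th -> th <= 1 ->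
      `|G t th - \sum_j w j t * phi j th| <= e * t).

(** * Elimination among the weights *)

Section Elimination.
Variables (J : Type) (w : J -> R -> R) (D : R -> Prop).
(** [F] is the coefficient tested at real [th] in [[0, 1]], [f] the one in the conclusion on [D].
    Two instances occur: [f = F] continuous with [D = [0, 1]], and [f 0] the derivative of [F] at 0
    with [D] reduced to 0. *)
Variable Rel : (R -> R) -> (R -> R) -> Prop.
Hypothesis Rel_lin : forall F f G g (a : R), Rel F f -> Rel G g ->
  Rel (fun th => F th - a * G th) (fun th => f th - a * g th).
Hypothesis Rel_zero : forall F f, Rel F f ->
  (forall th : R, 0 <= th -> th <= 1 -> F th = 0) -> forall th, D th -> f th = 0.
Hypothesis Rel_bounded : forall F f, Rel F f ->
  exists M : R, forall th, D th -> `|f th| <= M.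

(* If [F j] does not vanish at [th0], the relation at [th0] expresses [w j]
   through the other weights. *)
Lemma little_o_elimination (s : seq J) (F f : J -> R -> R) :
  (forall j, Rel (F j) (f j)) ->
  (forall th : R, 0 <= th -> th <= 1 -> little_o (fun t => \sum_(j <- s) w j t * F j th)) ->
  forall e : R, 0 < e -> ev0 (fun t => forall th, D th ->
    `|\sum_(j <- s) w j t * f j th| <= e * t).
Proof.
elim: s F f => [|j s IH] F f FR Fo e e0.
  by apply: ev0T => t t0 th _; rewrite big_nil normr0 mulr_ge0// ltW.
(* If [F j] vanishes, the hypotheses say nothing about [w j], but its coefficient in the conclusion
   vanishes as well. *)
have [Fj0|] := pselect (forall th : R, 0 <= th -> th <= 1 -> F j th = 0).
  have fj0 := Rel_zero (FR j) Fj0.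
  have Fo' th : 0 <= th -> th <= 1 -> little_o (fun t => \sum_(j <- s) w j t * F j th).
    move=> th0 th1; apply: little_o_eq (Fo th th0 th1) => t _.
    by rewrite big_cons Fj0// mulr0 add0r.
  apply: ev0W (IH F f FR Fo' e e0) => t t0 H th Dth.
  by rewrite big_cons fj0// mulr0 add0r; exact: H.
move=> /existsNP[u] /not_implyP[u0] /not_implyP[u1] /eqP Fju.
pose a i := F i u / F j u.
have Fo' th : 0 <= th -> th <= 1 ->
    little_o (fun t => \sum_(i <- s) w i t * (F i th - a i * F j th)).
  move=> th0 th1.
  apply: little_o_eq (little_oB (Fo th th0 th1) (little_oZ (F j th / F j u) (Fo u u0 u1))) => t _.
  rewrite !big_cons mulrDr opprD addrACA.
  have -> : w j t * F j th - F j th / F j u * (w j t * F j u) = 0 by field.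
  rewrite add0r mulr_sumr -sumrB; apply: eq_bigr => i _; rewrite /a.
  by field.
have [M HM] := Rel_bounded (FR j).
have M1 : 0 < `|M| + 1 by rewrite ltr_wpDl.
have e2 : 0 < e / 2 by rewrite divr_gt0.
have H1 := IH _ _ (fun i => Rel_lin (a i) (FR i) (FR j)) Fo' _ e2.
have := little_oZ ((`|M| + 1) / F j u) (Fo u u0 u1) => /(_ _ e2) H2.
apply: ev0W (ev0I H1 H2) => t t0 [A B] th Dth.
(* The eliminated term returns as a bounded multiple of the relation at [u], which is already
   [o(t)]. *)
have -> : \sum_(i <- j :: s) w i t * f i th =
    \sum_(i <- s) w i t * (f i th - a i * f j th) +
    f j th / F j u * \sum_(i <- j :: s) w i t * F i u.
  rewrite !big_cons mulrDr addrCA.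
  have -> : f j th / F j u * (w j t * F j u) = w j t * f j th by field.
  congr (_ + _); rewrite mulr_sumr -big_split/=; apply: eq_bigr => i _.
  by rewrite /a; field.
apply: le_trans (ler_normD _ _) _.
have := A th Dth.
set X := (X in _ + X).
suff : X <= e / 2 * t by lra.
apply: le_trans B; rewrite /X !normrM !ler_wpM2r// (ger0_norm (ltW M1)).
by apply: le_trans (HM _ Dth) _; apply: le_trans (ler_norm _) _; rewrite lerDl.
Qed.

End Elimination.

Lemma approximable_unif G : approximable G ->
  (forall th : R, 0 <= th -> th <= 1 -> little_o (G ^~ th)) ->
  forall e : R, 0 < e -> ev0 (fun t => forall th : R, 0 <= th -> th <= 1 -> `|G t th| <= e * t).
Proof.
move=> [J [w [phi [cphi Happ]]]] Go e e0.
have e2 : 0 < e / 2 by rewrite divr_gt0.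
have := @little_o_elimination J w (fun th => 0 <= th <= 1)
  (fun F f => F = f /\ continuous f) _ _ _ (index_enum J) phi phi _ _ _ e2.
case.
- move=> F f G' g a [-> cf] [-> cg]; split => // x.
  apply: cvgB; first exact: cf.
  by apply: cvgM; [exact: cvg_cst|exact: cg].
- by move=> F f [-> _] H th /andP[]; exact: H.
- move=> F f [_ cf]; have [M HM] := continuous_bounded01 cf.
  by exists M => th /andP[]; exact: HM.
- by move=> j; split.
- move=> th th0 th1 e' e'0; have e'2 : 0 < e' / 2 by rewrite divr_gt0.
  apply: ev0W (ev0I (Go th th0 th1 _ e'2) (Happ _ e'2)) => t t0 [A /(_ th th0 th1) B].
  rewrite -[X in `|X|](subrK (G t th)); apply: le_trans (ler_normD _ _) _.
  by rewrite distrC; lra.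
move=> d d0 Hd.
have Hd' : ev0 (fun t => forall th : R, 0 <= th <= 1 -> `|\sum_j w j t * phi j th| <= e / 2 * t).
  by exists d.
apply: ev0W (ev0I Hd' (Happ _ e2)) => t t0 [A B] th th0 th1.
rewrite -[X in `|X|](subrK (\sum_j w j t * phi j th)).
apply: le_trans (ler_normD _ _) _.
have := A th; rewrite th0 th1 => /(_ isT); have := B th th0 th1.
lra.
Qed.

(** Up to [o(t)], [D t th - D t 0] is [h] times the sum of the [w j] against primitives [Phi j] of
    the [phi j], so that sum is [o(t)] for each [th]; elimination transfers this to the derivatives
    at 0. Dividing by the fixed real [h] preserves [o(t)]. *)
Lemma approximable_derive (G D : R -> R -> R) (h : R) : approximable G -> h != 0 ->
  ev0 (fun t => forall th : R, 0 <= th -> th <= 1 -> is_derive th 1 (D t) (h * G t th)) ->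
  (forall th : R, 0 <= th -> th <= 1 -> little_o (fun t => D t th - D t 0)) ->
  little_o (G ^~ 0).
Proof.
move=> [J [w [phi [cphi Happ]]]] h0 DG Do e e0.
(* The window [(-1, 2)] contains [[0, 1]] in its interior, giving two-sided derivatives at 0 and
   1. *)
have HPhi j : exists F : R -> R, F 0 = 0 /\ forall x : R, -1 < x < 2 -> is_derive x 1 F (phi j x).
  by have [F F0 HF] := @antiderivative R (phi j) (-1) 2 0 (cphi j); exists F.
have [Phi HP] := choice _ HPhi.
have e2 : 0 < e / 2 by rewrite divr_gt0.
pose Rel (F f : R -> R) := is_derive (0 : R) 1 F (f 0).
have := @little_o_elimination J w (fun th => th = 0) Rel _ _ _ (index_enum J) Phi phi _ _ _ e2.
case.
- move=> F f G' g a HF HG.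
  exact: is_deriveB HF (is_deriveZ a HG).
(* Vanishing on [[0, 1]] constrains only the right of 0, so the derivative is tested at a positive
   [x]. *)
- move=> F f /is_deriveP HF F0 th ->.
  apply/eqP/negP => /negP f0.
  have f1 : 0 < `|f 0| / 2 by rewrite divr_gt0 ?normr_gt0.
  have [d d0 Hd] := HF _ f1.
  pose x := Num.min (d / 2) 1.
  have x0 : 0 < x by rewrite lt_min divr_gt0/=.
  have xd : `|x| < d.
    rewrite ger0_norm ?ltW//; apply: (@le_lt_trans _ _ (d / 2)); first by rewrite ge_min lexx.
    by rewrite ltr_pdivrMr// ltr_pMr// ltr1n.
  have := Hd x xd.
  have -> : F (0 + x *: 1) = 0.
    have -> : 0 + x *: 1 = x :> R by rewrite add0r; exact: mulr1.
    by apply: F0; [exact: ltW|rewrite ge_min lexx orbT].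
  rewrite F0// subrr sub0r normrN normrM (ger0_norm (ltW x0)) mulrC ler_pM2r//.
  by move: f1; lra.
- by move=> F f _; exists `|f 0| => th ->.
- by move=> j; apply: (HP j).2; rewrite ltrN10 ltr0n.
- move=> th th0 th1 e' e'0.
  have h1 : 0 < `|h| by rewrite normr_gt0.
  have e'2 : 0 < e' / 2 by rewrite divr_gt0.
  have e'h : 0 < e' * `|h| / 2 by rewrite divr_gt0// mulr_gt0.
  apply: ev0W (ev0I DG (ev0I (Do th th0 th1 _ e'h) (Happ _ e'2))) => t t0 [A [B C]].
  (* [K] collects the error of replacing [G] by its separated sum; its derivative, hence its
     increment, is small uniformly in [s]. *)
  pose K s := D t s - h * \sum_j w j t * Phi j s.
  pose dK s := h * (G t s - \sum_j w j t * phi j s).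
  have K1 : `|K th - K 0| <= `|h| * (e' / 2 * t).
    have [s [s0 s1 ->]] : exists s : R, [/\ 0 <= s, s <= 1 &
        K th - K 0 = (th - 0) * dK (0 + s * (th - 0))].
      apply: mvt_segment => s s0 s1.
      have sth0 : 0 <= 0 + s * (th - 0) by rewrite add0r subr0 mulr_ge0.
      have sth1 : 0 + s * (th - 0) <= 1 by rewrite add0r subr0 mulr_ile1.
      move: sth0 sth1; move: (0 + s * (th - 0)) => u sth0 sth1.
      rewrite /dK mulrBr.
      have -> : K = D t - (h \*: (fun s => \sum_j w j t * Phi j s)) by [].
      apply: is_deriveB; first exact: A.
      apply: is_deriveZ; apply: is_derive_bigsum => j.
      apply: (is_deriveZ (w j t)); apply: (HP j).2.
      rewrite (lt_le_trans _ sth0) ?ltrN10//=; apply: le_lt_trans sth1 _.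
      by rewrite ltr1n.
    rewrite /dK subr0 add0r !normrM (ger0_norm th0).
    have C' := C _ (mulr_ge0 s0 th0) (mulr_ile1 s0 th0 s1 th1).
    apply: le_trans (ler_wpM2l (normr_ge0 h) C').
    by rewrite ler_piMl// mulr_ge0.
  have : `|h * \sum_j w j t * Phi j th| <= `|h| * (e' * t).
    have -> : h * \sum_j w j t * Phi j th = (D t th - D t 0) - (K th - K 0).
      rewrite /K [\sum_j w j t * Phi j 0]big1; first by ring.
      by move=> j _; rewrite (HP j).1 mulr0.
    apply: le_trans (ler_normB _ _) _; move: B K1; lra.
  by rewrite normrM ler_pM2l.
move=> d d0 Hd.
have Hd' : ev0 (fun t => `|\sum_j w j t * phi j 0| <= e / 2 * t).
  by exists d => // t t0 td; exact: Hd.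
apply: ev0W (ev0I Hd' (Happ _ e2)) => t t0 [A /(_ 0 (lexx _) ler01) B].
rewrite -[X in `|X|](subrK (\sum_j w j t * phi j 0)).
apply: le_trans (ler_normD _ _) _; lra.
Qed.

Lemma approximableB F G : approximable F -> approximable G ->
  approximable (fun t th => F t th - G t th).
Proof.
move=> [J [w [phi [cphi HF]]]] [J' [w' [phi' [cphi' HG]]]].
exists (J + J')%type, (fun j => match j with inl i => w i | inr i => fun t => - w' i t end),
  (fun j => match j with inl i => phi i | inr i => phi' i end); split.
  by case.
move=> e e0; have e2 : 0 < e / 2 by rewrite divr_gt0.
apply: ev0W (ev0I (HF _ e2) (HG _ e2)) => t t0 [A B] th th0 th1.
rewrite big_sumType/=.
have -> : \sum_i - w' i t * phi' i th = - \sum_i w' i t * phi' i th.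
  by rewrite -sumrN; apply: eq_bigr => i _; rewrite mulNr.
have := A th th0 th1; have := B th th0 th1.
set x := F t th; set y := G t th; set y' := \sum_i _; set x' := \sum_i _ => h1 h2.
have -> : x - y - (x' - y') = (x - x') - (y - y') by ring.
apply: le_trans (ler_normB _ _) _; lra.
Qed.

(** * The algebra of exactly separable functions *)

Definition separable (G : R -> R -> R) :=
  exists (J : finType) (w phi : J -> R -> R), (forall j, continuous (phi j)) /\
    forall t th, G t th = \sum_j w j t * phi j th.

Lemma separable_prod (w phi : R -> R) : continuous phi -> separable (fun t th => w t * phi th).
Proof.
move=> cphi; exists unit, (fun=> w), (fun=> phi); split => // t th.
by rewrite (bigD1 tt)//= big1 ?addr0// => -[].
Qed.

Lemma separable_eq F G : (forall t th, F t th = G t th) -> separable F -> separable G.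
Proof. by move=> FG [J [w [phi [c H]]]]; exists J, w, phi; split => // t th; rewrite -FG. Qed.

Lemma separableD F G : separable F -> separable G -> separable (fun t th => F t th + G t th).
Proof.
move=> [J [w [phi [cphi HF]]]] [J' [w' [phi' [cphi' HG]]]].
exists (J + J')%type, (fun j => match j with inl i => w i | inr i => w' i end),
  (fun j => match j with inl i => phi i | inr i => phi' i end); split; first by case.
by move=> t th; rewrite big_sumType/= HF HG.
Qed.

Lemma separableM F G : separable F -> separable G -> separable (fun t th => F t th * G t th).
Proof.
move=> [J [w [phi [cphi HF]]]] [J' [w' [phi' [cphi' HG]]]].
exists (J * J')%type, (fun j t => w j.1 t * w' j.2 t), (fun j th => phi j.1 th * phi' j.2 th).
split=> [[j j'] x|t th]; first by apply: cvgM; [exact: cphi|exact: cphi'].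
rewrite HF HG big_distrlr/= pair_big/=; apply: eq_bigr => -[j j'] _ /=; ring.
Qed.

Lemma separable_sum (I : Type) (s : seq I) (F : I -> R -> R -> R) :
  (forall i, separable (F i)) -> separable (fun t th => \sum_(i <- s) F i t th).
Proof.
move=> HF; elim: s => [|i s IH].
  apply: separable_eq (separable_prod (fun=> 0) (@cst_continuous R R 0)) => t th.
  by rewrite big_nil mul0r.
by apply: separable_eq (separableD (HF i) IH) => t th; rewrite big_cons.
Qed.

Lemma separable_phi (phi : R -> R) : continuous phi -> separable (fun t th => phi th).
Proof.
by move=> /(separable_prod (fun=> 1)); apply: separable_eq => t th; rewrite mul1r.
Qed.

Lemma separable_w (w : R -> R) : separable (fun t th => w t).
Proof.
by have := separable_prod w (@cst_continuous R R 1); apply: separable_eq => t th; rewrite mulr1.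
Qed.

End SmoothGerms.

(** * Intervals of Fermat reals *)

Section Intervals.
Variable R : realType.
Implicit Types (x y z : FR R) (h k : R -> R).

Definition le_o h := forall e : R, 0 < e -> ev0 (fun t => h t <= e * t).

(** The slack [z] in the order can be taken to be the positive part of the difference. *)
Lemma FRleP x y : FRle x y <-> le_o (fun t => rep x t - rep y t).
Proof.
split=> [[z [_ z0 [d d0 xy]]] e e0|xy].
  have xy' : ev0 (fun t => rep x t <= rep y t + z t) by exists d.
  apply: ev0W (ev0I xy' (z0 e e0)) => t t0 [A]; rewrite subr0 => /(le_trans (ler_norm _)).
  by move: A; lra.
pose z t := Num.max 0 (rep x t - rep y t).
have zo : little_o z.
  move=> e e0; apply: ev0W (xy e e0) => t t0 A; rewrite ger0_norm; last by rewrite le_max lexx.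
  by rewrite ge_max A mulr_ge0// ltW.
exists z; split; [exact: Ro_little_o| |].
  by apply: little_o_eq zo => t _; rewrite subr0.
exists 1 => // t _ _; rewrite -lerBlDl /z le_max lexx orbT//.
Qed.

Lemma le_oD h k : le_o h -> le_o k -> le_o (fun t => h t + k t).
Proof.
move=> ho ko e e0; have e2 : 0 < e / 2 by rewrite divr_gt0.
by apply: ev0W (ev0I (ho _ e2) (ko _ e2)) => t t0 [A B]; lra.
Qed.

Lemma le_oZ (c : R) h : 0 <= c -> le_o h -> le_o (fun t => c * h t).
Proof.
move=> c0 ho e e0; have c1 : 0 < c + 1 by rewrite ltr_wpDl.
have ec : 0 < e / (c + 1) by rewrite divr_gt0.
apply: ev0W (ho _ ec) => t t0 A.
apply: le_trans (ler_wpM2l c0 A) _; rewrite mulrA ler_wpM2r//.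
by rewrite mulrA ler_pdivrMr// [c * e]mulrC ler_wpM2l ?ltW// ltrDl.
Qed.

Lemma little_o_le_o h : little_o h -> le_o h.
Proof. by move=> ho e e0; apply: ev0W (ho e e0) => t _; apply: le_trans; exact: ler_norm. Qed.

Lemma le_o_ev h k : (forall t, 0 <= t -> k t = h t) -> le_o h -> le_o k.
Proof. by move=> hk ho e e0; apply: ev0W (ho e e0) => t t0; rewrite hk. Qed.

Lemma le_o_little_o h : le_o h -> le_o (fun t => - h t) -> little_o h.
Proof.
move=> ho ho' e e0; apply: ev0W (ev0I (ho e e0) (ho' e e0)) => t _ [A B].
by rewrite ler_norml A andbT lerNl.
Qed.

(** Modulo [o(t)] both germs are nonpositive; if a convex combination with positive weight on [h]
    vanishes, so does [h]. This keeps strict inequalities strict along segments. *)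
Lemma le_o_convex_eq h k (s : R) : 0 <= s -> s < 1 -> le_o h -> le_o k ->
  little_o (fun t => (1 - s) * h t + s * k t) -> little_o h.
Proof.
move=> s0 s1 ho ko hk; apply: le_o_little_o => //.
have c0 : 0 < 1 - s by rewrite subr_gt0.
have c1 : 0 <= (1 - s)^-1 by rewrite invr_ge0 ltW.
have := le_oD (little_o_le_o (little_oN hk)) (le_oZ s0 ko).
move=> /(le_oZ c1); apply: le_o_ev => t _.
by field; rewrite gt_eqF.
Qed.

Definition on_segment x y (s : R) z := fequiv (rep z) (fun t => rep x t + s * (rep y t - rep x t)).

Lemma on_segment_exists x y (s : R) : exists z, on_segment x y s z.
Proof.
apply: FR_exists; apply: RoD; first exact: Ro_rep.
apply: RoM; first exact: Ro_cst.
have := RoD (Ro_rep y) (RoM (Ro_cst (-1)) (Ro_rep x)).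
by congr (Ro _); apply/funext => t; rewrite mulN1r.
Qed.

Lemma on_segment_std x y s z : on_segment x y s z -> std z = std x + s * (std y - std x).
Proof. by move=> /fequiv0. Qed.

Lemma on_segment1 x y z : on_segment x y 1 z -> z = y.
Proof.
move=> H; apply: FR_ext; apply: fequiv_trans H _; apply: fequiv_ev; apply: ev0T => t _.
by rewrite mul1r addrC subrK.
Qed.

Section Convexity.
Variables (x y z : FR R) (s : R).
Hypotheses (s0 : 0 <= s) (s1 : s <= 1) (xyz : on_segment x y s z).

Lemma FRle_convexl a : FRle a x -> FRle a y -> FRle a z.
Proof.
move=> /FRleP ax /FRleP ay; apply/FRleP.
have s1' : 0 <= 1 - s by rewrite subr_ge0.
have := le_oD (little_o_le_o (little_oN xyz)) (le_oD (le_oZ s1' ax) (le_oZ s0 ay)).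
by apply: le_o_ev => t _; ring.
Qed.

Lemma FRle_convexr b : FRle x b -> FRle y b -> FRle z b.
Proof.
move=> /FRleP ax /FRleP ay; apply/FRleP.
have s1' : 0 <= 1 - s by rewrite subr_ge0.
have := le_oD (little_o_le_o xyz) (le_oD (le_oZ s1' ax) (le_oZ s0 ay)).
by apply: le_o_ev => t _; ring.
Qed.

Lemma FRlt_convexl a : FRle a x -> FRle a y -> a <> x -> a <> y -> a <> z.
Proof.
move=> /FRleP ax /FRleP ay nx ny az; subst a.
have [sE|s_lt] := eqVneq s 1; first by apply: ny; apply: (@on_segment1 x); rewrite -sE.
apply: nx; apply: FR_ext.
have s1' : s < 1 by rewrite lt_neqAle s_lt.
apply: (le_o_convex_eq s0 s1' ax ay).
by apply: little_o_eq xyz => t _; ring.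
Qed.

Lemma FRlt_convexr b : FRle x b -> FRle y b -> x <> b -> y <> b -> z <> b.
Proof.
move=> /FRleP ax /FRleP ay nx ny az; subst b.
have [sE|s_lt] := eqVneq s 1; first by apply: ny; apply/esym; apply: (@on_segment1 x); rewrite -sE.
apply: nx; apply: FR_ext.
have s1' : s < 1 by rewrite lt_neqAle s_lt.
apply: (le_o_convex_eq s0 s1' ax ay).
by apply: little_o_eq (little_oN xyz) => t _; ring.
Qed.

Lemma FRbar_le_convexl a : FRbar_le a (FFin x) -> FRbar_le a (FFin y) -> FRbar_le a (FFin z).
Proof. by case: a => [a| |] //=; exact: FRle_convexl. Qed.

Lemma FRbar_le_convexr b : FRbar_le (FFin x) b -> FRbar_le (FFin y) b -> FRbar_le (FFin z) b.
Proof. by case: b => [b| |] //=; exact: FRle_convexr. Qed.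

Lemma FRbar_lt_convexl a : FRbar_lt a (FFin x) -> FRbar_lt a (FFin y) -> FRbar_lt a (FFin z).
Proof.
move=> [ax nx] [ay ny]; split; first exact: FRbar_le_convexl.
case: a ax nx ay ny => [a| |] //= ax nx ay ny [].
by apply: FRlt_convexl => // E; [apply: nx|apply: ny]; rewrite E.
Qed.

Lemma FRbar_lt_convexr b : FRbar_lt (FFin x) b -> FRbar_lt (FFin y) b -> FRbar_lt (FFin z) b.
Proof.
move=> [ax nx] [ay ny]; split; first exact: FRbar_le_convexr.
case: b ax nx ay ny => [b| |] //= ax nx ay ny [].
by apply: FRlt_convexr => // E; [apply: nx|apply: ny]; rewrite E.
Qed.

Lemma in_interval_convex kind a b :
  in_interval kind a b x -> in_interval kind a b y -> in_interval kind a b z.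
Proof.
case: kind => -[ax xb] [ay yb]; split;
  by [exact: FRbar_le_convexl ax ay|exact: FRbar_lt_convexl ax ay
     |exact: FRbar_le_convexr xb yb|exact: FRbar_lt_convexr xb yb].
Qed.

End Convexity.

Lemma FRle_std x y : FRle x y -> std x <= std y.
Proof.
by move=> [z [_ z0 [d d0 /(_ 0 (lexx _) d0)]]]; rewrite (fequiv0 z0) addr0.
Qed.

Lemma std_lt_FRle x y : std x < std y -> FRle x y.
Proof.
move=> xy; apply/FRleP => e e0.
have d0 : 0 < (std y - std x) / 2 by rewrite divr_gt0 ?subr_gt0.
apply: ev0W (ev0I (holder0_small d0 (rep_holder0 x)) (holder0_small d0 (rep_holder0 y))) => t t0.
rewrite !ltr_norml => -[/andP[_ A] /andP[B _]].
apply: (@le_trans _ _ 0); last by rewrite mulr_ge0// ltW.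
by lra.
Qed.

Lemma stdbar_lt (u v : FRbar R) : (stdbar u < stdbar v)%E -> FRbar_lt u v.
Proof.
move=> uv; split; last by move=> E; move: uv; rewrite E ltxx.
case: u v uv => [x| |] [y| |] //=.
by rewrite lte_fin; exact: std_lt_FRle.
Qed.

Lemma FRbar_le_std (u v : FRbar R) : FRbar_le u v -> (stdbar u <= stdbar v)%E.
Proof.
case: u v => [x| |] [y| |] //=; rewrite ?leey ?leNye//.
by rewrite lee_fin; exact: FRle_std.
Qed.

Section NonInfinitesimal.
Variables (kind : ikind) (a b : FRbar R).
Hypothesis ab : non_infinitesimal a b.
Local Notation S := (in_interval kind a b).

Lemma in_interval_std x : S x -> (stdbar a <= (std x)%:E <= stdbar b)%E.
Proof.
case: kind => -[] A B; apply/andP; split;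
  by [exact: (FRbar_le_std A)|exact: (FRbar_le_std A.1)|exact: (FRbar_le_std B)
     |exact: (FRbar_le_std B.1)].
Qed.

Lemma std_in_interval x : (stdbar a < (std x)%:E)%E -> ((std x)%:E < stdbar b)%E -> S x.
Proof.
move=> ax xb.
have A : FRbar_lt a (FFin x) by exact: stdbar_lt.
have B : FRbar_lt (FFin x) b by exact: stdbar_lt.
by case: (A) (B) => A1 _ [B1 _]; case: kind; split.
Qed.

(** The point may be, or be infinitely close to, an end point; since the standard parts of the ends
    differ, at least one side leaves room for a real step. Strict inequalities between standard
    parts then place [y] in the interval whatever its kind. *)
Lemma in_interval_shift x (rho : R) : S x -> 0 < rho ->
  exists (h : R) y, [/\ h != 0, `|h| <= rho, S y & fequiv (rep y) (fun t => rep x t + h)].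
Proof.
move=> Sx rho0.
suff [h [h0 hr ah bh]] : exists h : R, [/\ h != 0, `|h| <= rho,
    (stdbar a < (std x + h)%:E)%E & ((std x + h)%:E < stdbar b)%E].
  have [y yE] := FR_exists (RoD (Ro_rep x) (Ro_cst h)).
  have ys : std y = std x + h by exact: fequiv0 yE.
  by exists h, y; split => //; apply: std_in_interval; rewrite ys.
have /andP[ax xb] := in_interval_std Sx.
have [xb'|bx] := ltP (std x)%:E (stdbar b).
  have [h [h0 hr hb]] : exists h : R, [/\ 0 < h, h <= rho & ((std x + h)%:E < stdbar b)%E].
    move: xb'; case: (stdbar b) => [B| |] //.
      rewrite lte_fin => xB; exists (Num.min rho ((B - std x) / 2)); split.
      - by rewrite lt_min rho0 divr_gt0 ?subr_gt0.
      - by rewrite ge_min lexx.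
      rewrite lte_fin -ltrBrDl; apply: (@le_lt_trans _ _ ((B - std x) / 2)).
        by rewrite ge_min lexx orbT.
      by rewrite ltr_pdivrMr// ltr_pMr ?ltr1n// subr_gt0.
    by exists rho; split => //; rewrite ltry.
  exists h; split => //; [by rewrite gt_eqF|by rewrite gtr0_norm|].
  by apply: le_lt_trans ax _; rewrite lte_fin ltrDl.
have ax' : (stdbar a < (std x)%:E)%E by exact: lt_le_trans ab bx.
have [h [h0 hr hb]] : exists h : R, [/\ 0 < h, h <= rho & (stdbar a < (std x - h)%:E)%E].
  move: ax'; case: (stdbar a) => [A| |] //.
    rewrite lte_fin => xA; exists (Num.min rho ((std x - A) / 2)); split.
    - by rewrite lt_min rho0 divr_gt0 ?subr_gt0.
    - by rewrite ge_min lexx.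
    rewrite lte_fin ltrBrDl -ltrBrDr; apply: (@le_lt_trans _ _ ((std x - A) / 2)).
      by rewrite ge_min lexx orbT.
    by rewrite ltr_pdivrMr// ltr_pMr ?ltr1n// subr_gt0.
  by exists rho; split => //; rewrite ltNyr.
exists (- h); split => //; [by rewrite oppr_eq0 gt_eqF|by rewrite normrN gtr0_norm|].
by apply: lt_le_trans xb; rewrite lte_fin gtrDl oppr_lt0.
Qed.

End NonInfinitesimal.

End Intervals.

(** * Points made of parameters and one variable *)

Section Rows.
Variables (R : realType) (pp : nat).

Definition pt (P : 'I_pp -> R) (y : R) : 'rV[R]_(pp + 1) :=
  row_mx (\row_i P i) (\row_(j < 1) y).

Lemma pt_lshift P y i : pt P y ord0 (lshift 1 i) = P i.
Proof. by rewrite row_mxEl mxE. Qed.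

Lemma pt_rshift P y j : pt P y ord0 (rshift pp j) = y.
Proof. by rewrite row_mxEr mxE. Qed.

Lemma pt_line P y : pt P y = pt P 0 + y *: delta_mx 0 (last_coord pp).
Proof.
apply/rowP => k; rewrite [RHS]mxE [X in _ + X]mxE [delta_mx _ _ _ _]mxE.
case: (split_ordP k) => j ->; rewrite ?pt_lshift ?pt_rshift.
  by rewrite eq_lrshift andbF mulr0 addr0.
by rewrite ord1 /last_coord !eqxx mulr1 add0r.
Qed.

Lemma pt_segment P y z s : pt P (y + s * (z - y)) = pt P y + s *: (pt P z - pt P y).
Proof.
apply/rowP => k; rewrite [RHS]mxE [fun_of_matrix (s *: _) _ _]mxE [fun_of_matrix (_ - _) _ _]mxE.
rewrite [fun_of_matrix (- _) _ _]mxE.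
by case: (split_ordP k) => j ->; rewrite ?pt_lshift ?pt_rshift; ring.
Qed.

Lemma Ro_pt (p : 'I_pp -> R -> R) (y : R -> R) : (forall i, Ro (p i)) -> Ro y ->
  forall k, Ro (fun t => pt (p^~ t) (y t) ord0 k).
Proof.
move=> Rp Ry k; case: (split_ordP k) => j ->.
  by under eq_fun do rewrite pt_lshift; exact: Rp.
by under eq_fun do rewrite pt_rshift; exact: Ry.
Qed.

(** Convertible to the domain appearing in [local_rep]. *)
Definition dom (P : set 'rV[R]_pp) (V : set R) : set 'rV[R]_(pp + 1) :=
  [set z | P (lsubmx z) /\ V (rsubmx z ord0 ord0)].

Lemma dom_pt (P : set 'rV[R]_pp) (V : set R) p y :
  P (\row_i p i) -> V y -> dom P V (pt p y).
Proof. by move=> Pp Vy; split; rewrite ?row_mxKl// row_mxKr mxE. Qed.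

Lemma dom_open (P : set 'rV[R]_pp) (V : set R) : open P -> open V -> open (dom P V).
Proof.
move=> oP oV; rewrite openE => z [Pz Vz].
have [d d0 Hd] := nbhs_rV (open_nbhs_nbhs (conj oP Pz)).
have /nbhs_ballP[d' d'0 Hd'] := open_nbhs_nbhs (conj oV Vz).
apply: (@rV_nbhs _ _ _ _ (Num.min d d')); first by rewrite lt_min d0.
move=> z' Hz; split.
  by apply: Hd => i; rewrite !mxE; apply: lt_le_trans (Hz _) _; rewrite ge_min lexx.
apply: Hd'; rewrite /ball/= distrC !mxE; apply: lt_le_trans (Hz _) _.
by rewrite ge_min lexx orbT.
Qed.

Lemma is_derive_pt W b (p : 'I_pp -> R) (y : R) : Cinf_on W b -> W (pt p y) ->
  is_derive y 1 (fun y => b (pt p y)) (partial b (last_coord pp) (pt p y)).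
Proof.
move=> Wb Wp.
have -> : (fun y => b (pt p y)) = (fun y => b (pt p 0 + y *: delta_mx 0 (last_coord pp))).
  by apply/funext => s; rewrite -pt_line.
by apply: is_derive_line; rewrite -pt_line; exact: Cinf_is_derive Wb Wp.
Qed.

Lemma pt_box_small c (r r1 : R) (p : 'I_pp -> R -> R) (y : R -> R) :
  (forall i, Ro (p i)) -> Ro y -> r1 < r -> box c r1 (pt (p^~ 0) (y 0)) ->
  ev0 (fun t => forall k, `|pt (p^~ t) (y t) ord0 k - c ord0 k| < r).
Proof.
move=> Rp Ry r1r K0; apply: ev0_forall => k.
have rr : 0 < r - r1 by rewrite subr_gt0.
apply: ev0W (holder0_small rr (Ro_holder0 (Ro_pt Rp Ry k))) => t t0 A.
have := K0 k => B.
have -> : pt (p^~ t) (y t) ord0 k - c ord0 k = (pt (p^~ t) (y t) ord0 k -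
  pt (p^~ 0) (y 0) ord0 k) + (pt (p^~ 0) (y 0) ord0 k - c ord0 k) by ring.
by apply: le_lt_trans (ler_normD _ _) _; move: A B; lra.
Qed.

(** The displacement from the standard point is affine in [th] with weights in [t] alone, and
    derivatives at the standard point depend on [th] alone, so the Taylor polynomial is exactly
    separable. Clamping [th] keeps the family controlled on all of [R]. *)
Lemma segment_approximable W b c (r r1 : R) (p : 'I_pp -> R -> R) (y z : R -> R) :
  open W -> Cinf_on W b -> box c r `<=` W -> r1 < r ->
  (forall i, Ro (p i)) -> Ro y -> Ro z ->
  box c r1 (pt (p^~ 0) (y 0)) -> box c r1 (pt (p^~ 0) (z 0)) ->
  approximable (fun t th => b (pt (p^~ t) (y t + th * (z t - y t)))).
Proof.
move=> oW Wb KW r1r Rp Ry Rz Ky Kz.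
pose cl := clamp (0 : R) 1.
have cl01 th : 0 <= cl th <= 1 by exact: clamp_in.
pose q th t := pt (p^~ t) (y t + cl th * (z t - y t)).
pose h t := \sum_i `|p i t - p i 0| + (`|y t - y 0| + `|z t - z 0|).
have hh : holder0 h.
  apply: holder0D; first by apply: holder0_sum_norm => i; exact: Ro_holder0.
  by apply: holder0D; [have := Ro_holder0 Ry|have := Ro_holder0 Rz];
    apply: holder0_le => t _; rewrite normr_id.
have Kq th : box c r1 (q th 0).
  rewrite /q pt_segment; have /andP[c0 c1] := cl01 th.
  by apply: box_convex => //; rewrite addrC subrK.
have qh : ev0 (fun t => forall th i, `|q th t ord0 i - q th 0 ord0 i| <= h t).
  apply: ev0T => t t0 th k; rewrite /q /h; case: (split_ordP k) => j ->.
    rewrite !pt_lshift; apply: le_trans (ler_bigsum_norm (fun i => p i t - p i 0) j) _.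
    by rewrite lerDl addr_ge0.
  rewrite !pt_rshift; have /andP[c0 c1] := cl01 th; set s := cl th in c0 c1 *.
  have -> : y t + s * (z t - y t) - (y 0 + s * (z 0 - y 0)) =
    (1 - s) * (y t - y 0) + s * (z t - z 0) by ring.
  apply: le_trans (ler_normD _ _) _; rewrite !normrM (ger0_norm c0).
  rewrite (@ger0_norm _ (1 - s)) ?subr_ge0//.
  have : 0 <= \sum_i `|p i t - p i 0| by exact: sumr_ge0.
  have : (1 - s) * `|y t - y 0| <= `|y t - y 0| by rewrite ler_piMl// gerBl.
  have : s * `|z t - z 0| <= `|z t - z 0| by rewrite ler_piMl.
  lra.
have [N HN] := taylor_family oW Wb KW r1r Kq hh qh.
have sep : separable (fun t th => taylor N (q th t - q th 0) b (q th 0)).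
  have ccl : continuous cl by exact: continuous_clamp.
  have sep_q i : separable (fun t th => (q th t - q th 0) ord0 i).
    case: (split_ordP i) => j ->.
      apply: separable_eq (separable_w (fun t => p j t - p j 0)) => t th.
      by rewrite mxE [fun_of_matrix (- _) _ _]mxE !pt_lshift.
    have s1 := separable_w (fun t => y t - y 0).
    have s2 := separable_prod (fun t => (z t - z 0) - (y t - y 0)) ccl.
    apply: separable_eq (separableD s1 s2) => t th.
    by rewrite mxE [fun_of_matrix (- _) _ _]mxE !pt_rshift; ring.
  have base g : Cinf_on W g -> separable (fun t th => g (q th 0)).
    move=> Wg; apply: separable_phi => th.
    apply: (@continuous_comp _ _ _ cl (fun s => g (pt (p^~ 0) (y 0 + s * (z 0 - y 0))))).
      exact: ccl.
    have Wq : W (pt (p^~ 0) (y 0 + cl th * (z 0 - y 0))).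
      by apply: KW => i; apply: le_trans (Kq th i) _; exact: ltW.
    apply: is_derive_continuous.
    exact: (is_derive_affine (g := fun s => g (pt (p^~ 0) s)) (is_derive_pt Wg Wq)).
  have dirD_sep k g : Cinf_on W g -> separable (fun t th => dirD k (q th t - q th 0) g (q th 0)).
    elim: k g => [|k IH] g Wg /=; first exact: base.
    by apply: separable_sum => i; apply: separableM => //; apply: IH; exact: Cinf_partial.
  apply: separable_sum => k; apply: separableM; first exact: dirD_sep.
  exact: separable_w.
have [J [w [phi [cphi Hphi]]]] := sep.
exists J, w, phi; split => // e e0; apply: ev0W (HN e e0) => t t0 H th th0 th1.
have := H th; rewrite Hphi /q /cl clamp_id//.
by rewrite th0.
Qed.

End Rows.

(** * Local representations *)

Section Reindexing.
Variables (R : realType) (n m : nat) (W : set 'rV[R]_n) (sigma : 'I_n -> 'I_m) (j0 : 'I_m).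
Hypotheses (oW : open W) (sigma_inj : injective sigma).
Implicit Types (z : 'rV[R]_m) (b : 'rV[R]_n -> R) (g : 'rV[R]_m -> R).

Definition reindex z : 'rV[R]_n := \row_i z ord0 (sigma i).

Lemma reindex_continuous z : {for z, continuous reindex}.
Proof.
move=> A /nbhs_rV[d d0 Hd]; apply: (@rV_nbhs _ _ _ _ d) => // z' Hz.
by apply: Hd => i; rewrite !mxE.
Qed.

Lemma reindex_nbhs z : W (reindex z) -> \forall y \near z, W (reindex y).
Proof. by move=> Wz; apply: reindex_continuous; exact: open_nbhs_nbhs. Qed.

Lemma reindex_delta z h i :
  reindex (z + h *: delta_mx 0 (sigma i)) = reindex z + h *: delta_mx 0 i.
Proof. by apply/rowP => j; rewrite !mxE/= (inj_eq sigma_inj). Qed.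

Lemma reindex_delta_out z h j : (forall i, sigma i != j) ->
  reindex (z + h *: delta_mx 0 j) = reindex z.
Proof. by move=> Hj; apply/rowP => i; rewrite !mxE/= (negbTE (Hj i)) mulr0 addr0. Qed.

(** The case [a = 1], [c = 0] adds a coordinate to [b]. General constants make the shape stable
    under partial derivatives, which turn the linear term into a constant. *)
Definition affine_ext b (a c : R) : 'rV[R]_m -> R :=
  fun z => b (reindex z) + a * z ord0 j0 + c.

Lemma is_derive_affine_ext b (a c : R) z i : Cinf_on W b -> W (reindex z) ->
  is_derive z (delta_mx 0 (sigma i)) (affine_ext b a c)
    (partial b i (reindex z) + a * (j0 == sigma i)%:R).
Proof.
move=> Wb Wz; apply/is_deriveP => e e0.
have /is_deriveP /(_ e e0)[d d0 Hd] := Cinf_is_derive i Wb Wz.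
exists d => // h hd; apply: le_trans (Hd h hd).
rewrite /affine_ext reindex_delta !mxE/=.
rewrite [X in `|X| <= _](_ : _ = b (reindex z + h *: delta_mx 0 i) - b (reindex z) -
  h * partial b i (reindex z)) //.
by ring.
Qed.

Lemma is_derive_affine_ext_out b (a c : R) z j : (forall i, sigma i != j) ->
  is_derive z (delta_mx 0 j) (affine_ext b a c) (a * (j0 == j)%:R).
Proof.
move=> Hj; apply/is_deriveP => e e0; exists 1 => // h _.
rewrite /affine_ext reindex_delta_out// !mxE/=.
rewrite [X in `|X| <= _](_ : _ = 0) ?normr0 ?(mulr_ge0 (ltW e0))//.
by ring.
Qed.

Lemma affine_ext_continuous b a c z : Cinf_on W b -> W (reindex z) ->
  {for z, continuous (affine_ext b a c)}.
Proof.
move=> Wb Wz.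
have H1 : b (reindex y) @[y --> z] --> b (reindex z).
  apply: (@continuous_comp _ _ _ reindex b); first exact: reindex_continuous.
  exact: Cinf_continuous Wb Wz.
have H2 : (y : 'rV[R]_m) ord0 j0 @[y --> z] --> z ord0 j0 by exact: coord_continuous.
have FF : Filter (nbhs z) := nbhs_filter z.
have H3 := @cvgM _ _ (nbhs z) FF _ _ _ _ (@cvg_cst _ a _ (nbhs z) FF) H2.
have H4 := @cvgD _ _ _ (nbhs z) FF _ _ _ _ H1 H3.
exact: (@cvgD _ _ _ (nbhs z) FF _ _ _ _ H4 (@cvg_cst _ c _ (nbhs z) FF)).
Qed.

Lemma Cinf_zero : Cinf_on W (fun=> 0).
Proof.
have H s : iter_partial s (fun _ : 'rV[R]_n => 0 : R) = fun=> 0.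
  by elim: s => //= i s ->; apply/funext => z; rewrite /partial (derive_cst 0).
move=> s z Wz; rewrite H; split; first exact: cst_continuous.
by move=> i; exact: (derivable_cst 0).
Qed.

Lemma Cinf_affine_ext b a : Cinf_on W b ->
  Cinf_on [set z | W (reindex z)] (affine_ext b a 0).
Proof.
move=> Wb s.
have [b' [a' [c' [Wb' Hs]]]] : exists b' a' c', Cinf_on W b' /\ forall z, W (reindex z) ->
    iter_partial s (affine_ext b a 0) z = affine_ext b' a' c' z.
  elim: s => [|j s [b' [a' [c' [Wb' IH]]]]]; first by exists b, a, 0.
  have eqn z : W (reindex z) -> \forall y \near z,
      affine_ext b' a' c' y = iter_partial s (affine_ext b a 0) y.
    by move=> /reindex_nbhs; apply: filterS => y Wy; rewrite IH.
  have [[i ij]|] := pselect (exists i, sigma i = j).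
    exists (partial b' i), 0, (a' * (j0 == j)%:R); split; first exact: Cinf_partial.
    move=> z Wz.
    have [_ D] := near_eq_is_derive (eqn z Wz) (is_derive_affine_ext a' c' i Wb' Wz).
    by rewrite /affine_ext mul0r addr0 -{}ij; exact: D.
  move=> nj; have {}nj i : sigma i != j by apply/eqP => E; apply: nj; exists i.
  exists (fun=> 0), 0, (a' * (j0 == j)%:R); split; first exact: Cinf_zero.
  move=> z Wz.
  have [_ D] := near_eq_is_derive (eqn z Wz) (is_derive_affine_ext_out b' a' c' z nj).
  by rewrite /affine_ext mul0r addr0 add0r; exact: D.
move=> z Wz.
have eqn : \forall y \near z, affine_ext b' a' c' y = iter_partial s (affine_ext b a 0) y.
  by move: Wz => /reindex_nbhs; apply: filterS => y Wy; rewrite Hs.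
split.
  rewrite /prop_for /continuous_at Hs//.
  apply: cvg_trans (affine_ext_continuous Wb' Wz).
  exact: (@near_eq_cvg _ _ (nbhs z) _ (affine_ext b' a' c') _ eqn).
move=> j; have [[i <-]|nj] := pselect (exists i, sigma i = j).
  by case: (near_eq_is_derive eqn (is_derive_affine_ext a' c' i Wb' Wz)).
have {}nj i : sigma i != j by apply/eqP => E; apply: nj; exists i.
by case: (near_eq_is_derive eqn (is_derive_affine_ext_out b' a' c' z nj)).
Qed.

End Reindexing.

(** The local hypothesis is symmetric in [s1] and [s2], so [P] and its complement are both
    relatively open in [T]; connectedness concludes. *)
Lemma interval_induction (R : realType) (T P : set R) (s0 : R) :
  is_interval T -> T s0 -> P s0 ->
  (forall s, T s -> exists2 rho : R, 0 < rho & forall s1 s2, T s1 -> T s2 ->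
    `|s1 - s| < rho -> `|s2 - s| < rho -> P s1 -> P s2) ->
  forall s, T s -> P s.
Proof.
move=> iT T0 P0 H.
(* An open set of reals whose trace on [T] is that of [Q] as soon as [Q] is relatively open in
   [T]. *)
pose nb (Q : set R) : set R := [set z | exists s rho : R, [/\ `|z - s| < rho &
  forall s2, T s2 -> `|s2 - s| < rho -> Q s2]].
have nb_open Q : open (nb Q).
  rewrite openE => z [s [rho [zs HQ]]].
  apply/nbhs_ballP; exists (rho - `|z - s|) => /=; first by rewrite subr_gt0.
  move=> z'; rewrite /ball/= => zz; exists s, rho; split => //.
  have -> : z' - s = - (z - z') + (z - s) by ring.
  by apply: le_lt_trans (ler_normD _ _) _; rewrite normrN; lra.
have nbT (Q : set R) s : T s -> nb Q s -> Q s.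
  by move=> Ts [s' [rho [ss HQ]]]; exact: HQ.
have H1 s : T s -> P s -> nb P s.
  move=> Ts Ps; have [rho rho0 Hrho] := H s Ts.
  have ss : `|s - s| < rho by rewrite subrr normr0.
  by exists s, rho; split => // s2 T2 s2r; exact: (Hrho s s2).
have H2 s : T s -> ~ P s -> nb (~` P) s.
  move=> Ts Ps; have [rho rho0 Hrho] := H s Ts.
  have ss : `|s - s| < rho by rewrite subrr normr0.
  by exists s, rho; split => // s2 T2 s2r P2; apply: Ps; exact: (Hrho s2 s).
have /connected_intervalP cT := iT.
have TP : T `&` P = T.
  apply: cT; first by exists s0.
    exists (nb P) => //; apply/seteqP; split => s [Ts Ps]; split => //; first exact: H1.
    exact: nbT.
  exists (~` nb (~` P)); first exact: open_closedC.
  apply/seteqP; split => s [Ts Ps]; split => //.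
    by move=> /(nbT _ _ Ts).
  by apply: contrapT => /(H2 s Ts).
by move=> s; rewrite -TP => -[].
Qed.

(** * Local primitives and added constants *)

Section Primitives.
Variables (R : realType) (S : set (FR R)).
Implicit Types (f I : FR R -> FR R) (x y z d : FR R).

(** A single representation of [I] is asked for, but its derivative must represent [f] on all of
    [V]; [deriv_is] concerns all representations at one point. This form can be built and glued
    directly. *)
Definition primitive_at f I x :=
  exists (V : set R) (pp : nat) (P : set 'rV[R]_pp) (p : 'I_pp -> FR R)
    (A : 'rV[R]_(pp + 1) -> R),
  local_rep S I x V P p A /\ forall y, S y -> V (std y) ->
    fequiv (rep (f y)) (ext_rep (partial A (last_coord pp)) p y).

Lemma ext_repE pp (A : 'rV[R]_(pp + 1) -> R) p y t :
  ext_rep A p y t = A (pt (fun i => rep (p i) t) (rep y t)).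
Proof. by []. Qed.

Lemma local_rep_std_dom I x V pp (P : set 'rV[R]_pp) p A s :
  local_rep S I x V P p A -> V s -> dom P V (pt (fun i => std (p i)) s).
Proof. by move=> [_ [_ Pp] _ _] Vs; exact: dom_pt. Qed.

Lemma local_rep_move I x y V pp (P : set 'rV[R]_pp) p A :
  local_rep S I x V P p A -> V (std y) -> local_rep S I y V P p A.
Proof. by move=> [[oV _] HP HA HI] Vy. Qed.

Lemma local_rep_value I x V pp (P : set 'rV[R]_pp) p A y (w : R -> R) :
  local_rep S I x V P p A -> S y -> V (std y) -> fequiv (rep y) w ->
  fequiv (rep (I y)) (fun t => A (pt (fun i => rep (p i) t) (w t))).
Proof.
move=> HI Sy Vy yw; have [[oV _] [oP Pp] CA Ival] := HI.
apply: fequiv_trans (Ival y Sy Vy) _.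
apply: (@smooth_fequiv _ _ _ _ (dom_open oP oV) CA (fun t => pt (fun i => rep (p i) t) (rep y t))
  (fun t => pt (fun i => rep (p i) t) (w t))).
- by apply: Ro_pt => [i|]; exact: Ro_rep.
- exact: local_rep_std_dom HI Vy.
- move=> k; case: (split_ordP k) => j ->.
    by apply: little_o_eq (@little_o0 R) => t _; rewrite !pt_lshift subrr.
  by apply: little_o_eq yw => t _; rewrite !pt_rshift.
Qed.

Definition along pp (A : 'rV[R]_(pp + 1) -> R) (p : 'I_pp -> FR R) (y z : R -> R) (t th : R) :=
  A (pt (fun i => rep (p i) t) (y t + th * (z t - y t))).

(** The radius is half that of a box in the domain: the other half is the margin for curves at small
    positive [t]. *)
Lemma local_rep_segment I x V pp (P : set 'rV[R]_pp) p A :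
  local_rep S I x V P p A -> exists rho : R, [/\ 0 < rho,
    forall s, `|s - std x| <= rho -> V s &
    forall y z : R -> R, Ro y -> Ro z -> `|y 0 - std x| <= rho -> `|z 0 - std x| <= rho ->
      let G := along (partial A (last_coord pp)) p y z in
      approximable G /\ ev0 (fun t => forall th : R, 0 <= th -> th <= 1 ->
        is_derive th 1 (along A p y z t) ((z t - y t) * G t th))].
Proof.
move=> HI; have [[oV Vx] [oP Pp] CA Ival] := HI.
have oW := dom_open oP oV.
have [r r0 KW] := open_box oW (local_rep_std_dom HI Vx).
set c := pt _ _ in KW.
have r2 : 0 < r / 2 by rewrite divr_gt0.
have rr : r / 2 < r by rewrite ltr_pdivrMr// ltr_pMr// ltr1n.
have Kc s (r' : R) : 0 <= r' -> `|s - std x| <= r' -> box c r' (pt (fun i => std (p i)) s).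
  move=> r'0 sr k; rewrite /c; case: (split_ordP k) => j ->.
    by rewrite !pt_lshift subrr normr0.
  by rewrite !pt_rshift.
exists (r / 2); split => //.
  move=> s sr; have [_] := KW _ (Kc s r (ltW r0) (le_trans sr (ltW rr))).
  by rewrite /pt row_mxKr mxE.
move=> y z Ry Rz y0 z0 G.
have Ky := Kc _ _ (ltW r2) y0; have Kz := Kc _ _ (ltW r2) z0.
have Rp i : Ro (rep (p i)) by exact: Ro_rep.
split.
  exact: (segment_approximable oW (Cinf_partial (last_coord pp) CA) KW rr
    (p := fun i => rep (p i))).
have By := pt_box_small Rp Ry rr Ky; have Bz := pt_box_small Rp Rz rr Kz.
apply: ev0W (ev0I By Bz) => t t0 [Hy Hz] th th0 th1.
apply: (is_derive_affine (g := fun s => A (pt (fun i => rep (p i) t) s))).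
apply: is_derive_pt CA _; apply: KW; rewrite pt_segment; apply: box_convex => //.
  by move=> k; exact/ltW/Hy.
by rewrite addrC subrK => k; exact/ltW/Hz.
Qed.

Lemma primitive_at_local f I I' x (V : set R) : open V -> V (std x) ->
  (forall y, S y -> V (std y) -> I' y = I y) -> primitive_at f I x -> primitive_at f I' x.
Proof.
move=> oV Vx II' [V1 [pp [P [p [A [[[oV1 V1x] HP CA HI] HA]]]]]].
exists (V `&` V1), pp, P, p, A; split; last by move=> y Sy [_]; exact: HA.
split => //; first by split; [exact: openI|split].
  by apply: Cinf_subset CA => w [Pw []].
by move=> y Sy [Vy V1y]; rewrite II'//; exact: HI.
Qed.

Lemma smooth_primitive_at f I : smooth_on S I ->
  (forall x, S x -> deriv_is S I x (f x)) -> forall x, S x -> primitive_at f I x.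
Proof.
move=> sI dI x Sx; have [V [pp [P [p [A HI]]]]] := sI x Sx.
exists V, pp, P, p, A; split => // y Sy Vy.
exact: dI y Sy _ _ _ _ _ (local_rep_move HI Vy).
Qed.

Lemma primitive_at_smooth f I : (forall x, S x -> primitive_at f I x) -> smooth_on S I.
Proof.
by move=> H x /H[V [pp [P [p [A [HI _]]]]]]; exists V, pp, P, p, A.
Qed.

(** [A] is real-valued and cannot absorb a Fermat constant, so [d] becomes a parameter between [p]
    and the variable, and the new representation is [A] plus that coordinate. *)
Lemma primitive_at_add f I I' x d :
  (forall y, S y -> fequiv (rep (I' y)) (fun t => rep (I y) t + rep d t)) ->
  primitive_at f I x -> primitive_at f I' x.
Proof.
move=> II' [V [pp [P [p [A [HI HA]]]]]].
have [[oV Vx] [oP Pp] CA Ival] := HI.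
pose p' (k : 'I_(pp + 1)) := match fintype.split k with inl i => p i | inr _ => d end.
have p'l i : p' (lshift 1 i) = p i by rewrite /p' (unsplitK (inl i)).
have p'r j : p' (rshift pp j) = d by rewrite /p' (unsplitK (inr j)).
pose P' : set 'rV[R]_(pp + 1) := [set w | P (lsubmx w)].
(* [sigma] skips the slot of [d]: old parameters keep their places, the variable moves from position
   [pp] to [pp + 1]. *)
pose sigma (k : 'I_(pp + 1)) : 'I_((pp + 1) + 1) :=
  match fintype.split k with inl i => lshift 1 (lshift 1 i) | inr j => rshift (pp + 1) j end.
have sl i : sigma (lshift 1 i) = lshift 1 (lshift 1 i) by rewrite /sigma (unsplitK (inl i)).
have sr j : sigma (rshift pp j) = rshift (pp + 1) j by rewrite /sigma (unsplitK (inr j)).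
have sigma_inj : injective sigma.
  move=> k k'; case: (split_ordP k) => j ->; case: (split_ordP k') => j' ->; rewrite ?sl ?sr.
  - by move=> /lshift_inj ->.
  - by move=> /eqP; rewrite eq_lrshift.
  - by move=> /eqP; rewrite eq_rlshift.
  - by move=> /rshift_inj ->.
pose j0 : 'I_((pp + 1) + 1) := lshift 1 (rshift pp ord0).
have oW := dom_open oP oV.
have oP' : open P'.
  have := dom_open oP openT; congr (open _).
  by apply/seteqP; split => w // [].
have reE (q : 'I_(pp + 1) -> R) (y : R) : reindex sigma (pt q y) = pt (fun i => q (lshift 1 i)) y.
  apply/rowP => k; rewrite mxE; case: (split_ordP k) => j ->.
    by rewrite sl !pt_lshift.
  by rewrite sr !pt_rshift.
have ptj0 (q : 'I_(pp + 1) -> R) (y : R) : pt q y ord0 j0 = q (rshift pp ord0).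
  exact: pt_lshift.
have HP' : P' (\row_i std (p' i)).
  rewrite /P' /=; have -> : lsubmx (\row_i std (p' i)) = \row_i std (p i) => //.
  by apply/rowP => i; rewrite !mxE p'l.
have WP : [set w : 'rV[R]_((pp + 1) + 1) | P' (lsubmx w) /\ V (rsubmx w ord0 ord0)]
    `<=` [set w | dom P V (reindex sigma w)].
  move=> w [Pw Vw]; split => /=.
    have -> : lsubmx (reindex sigma w) = lsubmx (lsubmx w) => //.
    by apply/rowP => i; rewrite !mxE sl.
  have -> : rsubmx (reindex sigma w) ord0 ord0 = rsubmx w ord0 ord0 => //.
  by rewrite !mxE sr.
have CA' := Cinf_affine_ext j0 oW sigma_inj 1 CA.
have pE t : (fun i => rep (p' (lshift 1 i)) t) = (fun i => rep (p i) t).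
  by apply/funext => i; rewrite p'l.
exists V, (pp + 1)%N, P', p', (affine_ext sigma j0 A 1 0); split.
  split => //.
  - exact: Cinf_subset WP CA'.
  - move=> y Sy Vy; apply: fequiv_trans (II' y Sy) _.
    have := fequivD (Ival y Sy Vy) (fequiv_refl (rep d)).
    congr (fequiv _ _); apply/funext => t.
    by rewrite !ext_repE /affine_ext reE pE ptj0 p'r mul1r addr0.
move=> y Sy Vy; apply: fequiv_trans (HA y Sy Vy) _.
have Ry : forall k, Ro (fun t => pt (fun i => rep (p i) t) (rep y t) ord0 k).
  by apply: Ro_pt => [i|]; exact: Ro_rep.
have W0 := local_rep_std_dom HI Vy.
have [r r0 KW] := open_box oW W0.
have K0 : box (pt (fun i => std (p i)) (std y)) (r / 2) (pt (fun i => rep (p i) 0) (rep y 0)).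
  by apply: box_center; rewrite divr_ge0 ?ltW.
have rr : r / 2 < r by rewrite ltr_pdivrMr// ltr_pMr// ltr1n.
have := pt_box_small (fun i => Ro_rep (p i)) (Ro_rep y) rr K0.
move=> small; apply: fequiv_ev; apply: ev0W small => t t0 Ht.
rewrite !ext_repE.
have Wt : dom P V (reindex sigma (pt (fun i => rep (p' i) t) (rep y t))).
  by rewrite reE pE; apply: KW => k; exact/ltW/Ht.
(* The slot [j0] of [d] is not the last coordinate, so the added term contributes zero to the
   derivative. *)
have := is_derive_affine_ext j0 sigma_inj 1 0 (last_coord pp) CA Wt.
rewrite {1}/last_coord sr => -[_].
rewrite eq_lrshift mulr0 addr0 reE pE => D.
exact: (esym D).
Qed.

End Primitives.

(** * Derivatives, uniqueness and gluing of primitives *)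

Section IntervalPrimitives.
Variables (R : realType) (kind : ikind) (a b : FRbar R).
Hypothesis ab : non_infinitesimal a b.
Local Notation S := (in_interval kind a b).
Implicit Types (f I : FR R -> FR R) (x y z d : FR R).

Lemma std_interval : is_interval [set s | exists2 x, S x & std x = s].
Proof.
move=> _ _ [x Sx <-] [y Sy <-] s /andP[xs sy].
have [xy|] := ltP (std x) (std y); last first.
  by move=> yx; exists x => //; apply/eqP; rewrite eq_le xs (le_trans sy).
pose th := (s - std x) / (std y - std x).
have xy0 : 0 < std y - std x by rewrite subr_gt0.
have th0 : 0 <= th by rewrite divr_ge0 ?subr_ge0// ltW.
have th1 : th <= 1 by rewrite ler_pdivrMr// mul1r lerD2r.
have [z Hz] := on_segment_exists x y th.
exists z; first exact: (in_interval_convex th0 th1 Hz Sx Sy).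
by rewrite (on_segment_std Hz) /th divfK ?gt_eqF// addrC subrK.
Qed.

Lemma std_segment x y z (s rho c : R) : on_segment x y s z -> 0 <= s -> s <= 1 ->
  `|std x - c| <= rho -> `|std y - c| <= rho -> `|std z - c| <= rho.
Proof.
move=> /on_segment_std -> s0 s1; rewrite !ler_distl => /andP[x1 x2] /andP[y1 y2].
by apply/andP; split; nra.
Qed.

(** Both representations give the same [I w] at every [w] with real parameter [th] on the segment;
    [approximable_derive] turns this into equality of derivatives at [x]. As [h] may be negative,
    both ends of the interval are covered. *)
Lemma primitive_at_deriv f I x : S x -> primitive_at S f I x -> deriv_is S I x (f x).
Proof.
move=> Sx [V [pp [P [p [A [HI HA]]]]]] V' pp' P' p' A' HI'.
have [rho [rho0 rV Hseg]] := local_rep_segment HI.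
have [rho' [rho'0 rV' Hseg']] := local_rep_segment HI'.
have [h [y [h0 hr Sy yh]]] : exists (h : R) y, [/\ h != 0, `|h| <= Num.min rho rho', S y &
    fequiv (rep y) (fun t => rep x t + h)].
  by apply: in_interval_shift => //; rewrite lt_min rho0.
have [hrho hrho'] : `|h| <= rho /\ `|h| <= rho' by move: hr; rewrite le_min => /andP[].
pose z t := rep x t + h.
have Rz : Ro z by apply: RoD; [exact: Ro_rep|exact: Ro_cst].
have xx (r : R) : 0 < r -> `|rep x 0 - std x| <= r by rewrite subrr normr0 => /ltW.
have zx : z 0 - std x = h by rewrite /z addrAC subrr add0r.
have [||apG dD] := Hseg (rep x) z (Ro_rep x) Rz; [exact: xx|by rewrite zx|].
have [||apG' dD'] := Hseg' (rep x) z (Ro_rep x) Rz; [exact: xx|by rewrite zx|].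
set G := along _ _ _ _ in apG dD; set G' := along _ _ _ _ in apG' dD'.
set D := along A _ _ _ in dD; set D' := along A' _ _ _ in dD'.
have Dth th : 0 <= th -> th <= 1 -> little_o (fun t => D t th - D' t th).
  move=> th0 th1; have [w Hw] := on_segment_exists x y th.
  have Sw : S w by exact: (in_interval_convex th0 th1 Hw Sx Sy).
  have sy : std y - std x = h by rewrite -zx -[std y]/(rep y 0) (fequiv0 yh).
  have wr (r : R) : `|h| <= r -> 0 < r -> `|std w - std x| <= r.
    move=> hr1 r0; apply: (std_segment Hw th0 th1); first exact: xx.
    by rewrite sy.
  have ww : fequiv (rep w) (fun t => rep x t + th * (z t - rep x t)).
    apply: fequiv_trans Hw _; apply: little_o_eq (little_oZ th yh) => t _.
    by rewrite /z; ring.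
  have B := local_rep_value HI Sw (rV _ (wr _ hrho rho0)) ww.
  have B' := local_rep_value HI' Sw (rV' _ (wr _ hrho' rho'0)) ww.
  exact: fequiv_trans (fequiv_sym B) B'.
have : little_o (fun t => G t 0 - G' t 0).
  apply: (approximable_derive (G := fun t th => G t th - G' t th)
    (D := fun t th => D t th - D' t th) (approximableB apG apG') h0).
    apply: ev0W (ev0I dD dD') => t t0 [HD HD'] th th0 th1.
    have zh : z t - rep x t = h by rewrite /z addrAC subrr add0r.
    rewrite mulrBr -{1}zh -{1}zh; exact: is_deriveB (HD th th0 th1) (HD' th th0 th1).
  move=> th th0 th1.
  exact: little_oB (Dth th th0 th1) (Dth 0 (lexx _) ler01).
have Vx : V (std x) by case: HI => -[].
move=> GG; apply: fequiv_trans (HA x Sx Vx) _.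
apply: little_o_eq GG => t _.
by rewrite !ext_repE /G /G' /along !mul0r !addr0.
Qed.

(** Comparing increments avoids building a representation of [I1 - I2]. Both derivatives represent
    [f] along the segment, so they differ by [o(t)] at each [th], and then uniformly. *)
Lemma primitive_at_unique f I1 I2 x : primitive_at S f I1 x -> primitive_at S f I2 x ->
  exists2 rho : R, 0 < rho & forall y z, S y -> S z -> `|std y - std x| <= rho ->
    `|std z - std x| <= rho ->
    fequiv (fun t => rep (I1 y) t - rep (I2 y) t) (fun t => rep (I1 z) t - rep (I2 z) t).
Proof.
move=> [V [pp [P [p [A [HI HA]]]]]] [V' [pp' [P' [p' [A' [HI' HA']]]]]].
have [rho [rho0 rV Hseg]] := local_rep_segment HI.
have [rho' [rho'0 rV' Hseg']] := local_rep_segment HI'.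
exists (Num.min rho rho'); first by rewrite lt_min rho0.
move=> y z Sy Sz; rewrite !le_min => /andP[yr yr'] /andP[zr zr'].
have [apG dD] := Hseg _ _ (Ro_rep y) (Ro_rep z) yr zr.
have [apG' dD'] := Hseg' _ _ (Ro_rep y) (Ro_rep z) yr' zr'.
set G := along _ _ _ _ in apG dD; set G' := along _ _ _ _ in apG' dD'.
set D := along A _ _ _ in dD; set D' := along A' _ _ _ in dD'.
have Gth th : 0 <= th -> th <= 1 -> little_o (fun t => G t th - G' t th).
  move=> th0 th1; have [w Hw] := on_segment_exists y z th.
  have Sw : S w by exact: (in_interval_convex th0 th1 Hw Sy Sz).
  have Vw : V (std w) by apply: rV; exact: (std_segment Hw).
  have Vw' : V' (std w) by apply: rV'; exact: (std_segment Hw).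
  have B := HA w Sw Vw; have B' := HA' w Sw Vw'.
  have move_path qq (Q : set 'rV[R]_qq) (U : set R) (q : 'I_qq -> FR R) g :
      local_rep S I1 x U Q q g \/ local_rep S I2 x U Q q g -> U (std w) ->
      fequiv (ext_rep (partial g (last_coord qq)) q w) (fun t => partial g (last_coord qq)
        (pt (fun i => rep (q i) t) (rep y t + th * (rep z t - rep y t)))).
    move=> Hrep Uw.
    have [oU [oQ Qq] Cg] : [/\ open U, open Q /\ Q (\row_(i < qq) std (q i)) & Cinf_on (dom Q U) g].
      by case: Hrep => -[[oU _] oQ Cg _].
    apply: (@smooth_fequiv _ _ (dom Q U) _ (dom_open oQ oU) (Cinf_partial (last_coord qq) Cg)
      (fun t => pt (fun i => rep (q i) t) (rep w t))
      (fun t => pt (fun i => rep (q i) t) (rep y t + th * (rep z t - rep y t)))).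
    - by apply: Ro_pt => [i|]; exact: Ro_rep.
    - exact: dom_pt.
    - move=> k; case: (split_ordP k) => j ->.
        by apply: little_o_eq (@little_o0 R) => t _; rewrite !pt_lshift subrr.
      by apply: little_o_eq Hw => t _; rewrite !pt_rshift.
  have C := move_path _ _ _ _ _ (or_introl HI) Vw.
  have C' := move_path _ _ _ _ _ (or_intror HI') Vw'.
  apply: fequiv_trans (fequiv_sym C) _; apply: fequiv_trans C'.
  exact: fequiv_trans (fequiv_sym B) B'.
have unif := approximable_unif (approximableB apG apG') Gth.
have [M M0 zyM] : bounded0 (fun t => rep z t - rep y t).
  apply: Ro_bounded; have := RoD (Ro_rep z) (RoM (Ro_cst (-1)) (Ro_rep y)).
  by congr (Ro _); apply/funext => t; rewrite mulN1r.
have endpoints qq (Q : set 'rV[R]_qq) (U : set R) (q : 'I_qq -> FR R) g J w s :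
    local_rep S J x U Q q g -> S w -> U (std w) ->
    (forall t, rep y t + s * (rep z t - rep y t) = rep w t) ->
    fequiv (rep (J w)) (fun t => g (pt (fun i => rep (q i) t) (rep y t + s * (rep z t - rep y t)))).
  move=> Hrep Sw Uw E; apply: (local_rep_value Hrep Sw Uw).
  by apply: little_o_eq (@little_o0 R) => t _; rewrite E subrr.
have E0 t : rep y t + 0 * (rep z t - rep y t) = rep y t by rewrite mul0r addr0.
have E1 t : rep y t + 1 * (rep z t - rep y t) = rep z t by rewrite mul1r addrC subrK.
have Iy : fequiv (rep (I1 y)) (D^~ 0) by exact: endpoints HI Sy (rV _ yr) E0.
have Iz : fequiv (rep (I1 z)) (D^~ 1) by exact: endpoints HI Sz (rV _ zr) E1.
have Iy' : fequiv (rep (I2 y)) (D'^~ 0) by exact: endpoints HI' Sy (rV' _ yr') E0.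
have Iz' : fequiv (rep (I2 z)) (D'^~ 1) by exact: endpoints HI' Sz (rV' _ zr') E1.
apply: fequiv_trans (fequivB Iy Iy') _.
apply: fequiv_sym; apply: fequiv_trans (fequivB Iz Iz') _.
(* [M] bounds [z - y] for small [t], so accuracy [e / M] on derivatives yields [e] on increments. *)
move=> e e0; have eM : 0 < e / M by rewrite divr_gt0.
apply: ev0W (ev0I (ev0I dD dD') (ev0I zyM (unif _ eM))) => t t0 [[HD HD'] [HM HU]].
apply: (@mvt01_le _ (fun th => D t th - D' t th)
  (fun th => (rep z t - rep y t) * (G t th - G' t th))) => th th0 th1.
  rewrite mulrBr; exact: is_deriveB (HD th th0 th1) (HD' th th0 th1).
rewrite normrM; apply: le_trans (ler_pM _ _ HM (HU th th0 th1)) _ => //.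
by rewrite mulrA mulrCA divff ?mulr1 ?gt_eqF.
Qed.

(** Stated over an interval [V] of standard parts because gluing uses it on overlaps; [setT] gives
    the global case. *)
Lemma primitive_unique f I1 I2 (V : set R) x0 : is_interval V ->
  (forall x, S x -> V (std x) -> primitive_at S f I1 x /\ primitive_at S f I2 x) ->
  S x0 -> V (std x0) -> I1 x0 = I2 x0 -> forall x, S x -> V (std x) -> I1 x = I2 x.
Proof.
move=> iV prim Sx0 Vx0 E0.
have diff y z : fequiv (fun t => rep (I1 y) t - rep (I2 y) t) (fun t => rep (I1 z) t - rep (I2 z) t) ->
    I1 y = I2 y -> I1 z = I2 z.
  move=> H E; apply: FR_ext; move: H; rewrite E => /fequiv_sym.
  by apply: little_o_eq => t _; rewrite subrr subr0.
pose T := [set s | (exists2 x, S x & std x = s) /\ V s].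
have iT : is_interval T.
  move=> s1 s2 [T1 V1] [T2 V2] s s12.
  by split; [exact: std_interval s12|exact: iV s12].
have key := @interval_induction R T (fun s => forall x, S x -> std x = s -> I1 x = I2 x) (std x0) iT.
move=> x Sx Vx; apply: (key _ _ _ (std x)) => //; [by split; [exists x0|]| | |by split; [exists x|]].
(* The starting claim already concerns every point infinitely close to [x0]. *)
- move=> y Sy yx0.
  have [P1 P2] := prim x0 Sx0 Vx0.
  have [rho rho0 H] := primitive_at_unique P1 P2.
  by apply: (diff _ _ _ E0); apply: H => //; rewrite ?yx0 subrr normr0 ltW.
- move=> s [[y Sy <-] Vy].
  have [P1 P2] := prim y Sy Vy.
  have [rho rho0 H] := primitive_at_unique P1 P2.
  exists rho => // s1 s2 [[y1 Sy1 <-] _] _ r1 r2 HP z Sz zs2.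
  by apply: (diff _ _ _ (HP y1 Sy1 erefl)); apply: H => //; rewrite ?zs2 ltW.
Qed.

Lemma ball_interval (c r : R) : is_interval [set s : R | `|s - c| < r].
Proof.
move=> s1 s2 /=; rewrite !ltr_distl => /andP[A _] /andP[_ B] s /andP[C D].
by rewrite ltr_distl (lt_le_trans A C) (le_lt_trans D B).
Qed.

Lemma ball_open (c r : R) : open [set s : R | `|s - c| < r].
Proof.
have := @ball_open R R c r; congr (open _).
by apply/seteqP; split => s /=; rewrite /ball/= distrC.
Qed.

(** Integration starts at the real number [std x0]. The parameters are restricted to a cube [Q] so
    that [Q] times the ball [U] lies in the open box where [A] is smooth. *)
Lemma local_primitive f x0 : smooth_on S f -> S x0 -> exists (rho : R) I, 0 < rho /\
  forall x, S x -> `|std x - std x0| < rho -> primitive_at S f I x.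
Proof.
move=> sf Sx0; have [V [pp [P [p [alpha Hf]]]]] := sf x0 Sx0.
have [[oV Vx0] [oP Pp] Calpha fval] := Hf.
have oW := dom_open oP oV.
pose c := pt (fun i => std (p i)) (std x0).
have [r r0 KW] : exists2 r : R, 0 < r & box c r `<=` dom P V.
  by apply: open_box => //; exact: local_rep_std_dom Hf Vx0.
have [A CA dA] := parametric_primitive (last_coord pp) oW r0 KW Calpha.
have oO : open (obox c r) by rewrite openE => w; exact: obox_open.
pose I y := toFR (ext_rep A p y).
pose U := [set s : R | `|s - std x0| < r].
pose Q := obox (\row_i std (p i)) r.
have cE s : U s -> obox c r (pt (fun i => std (p i)) s).
  move=> Us k; rewrite /c; case: (split_ordP k) => j ->.
    by rewrite !pt_lshift subrr normr0.
  by rewrite !pt_rshift.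
have UV s : U s -> V s.
  by move=> /cE/obox_sub/KW[_]; rewrite /pt row_mxKr mxE.
have QU : [set w : 'rV[R]_(pp + 1) | Q (lsubmx w) /\ U (rsubmx w ord0 ord0)] `<=` obox c r.
  move=> w [Qw Uw] k; rewrite /c; case: (split_ordP k) => j ->.
    by rewrite pt_lshift; have := Qw j; rewrite !mxE.
  by rewrite pt_rshift; move: Uw; rewrite /U/= mxE (ord1 j).
have RA y : U (std y) -> Ro (ext_rep A p y).
  move=> Uy; apply: (Ro_smooth oO CA (x := fun t => pt (fun i => rep (p i) t) (rep y t))).
    by apply: Ro_pt => [i|]; exact: Ro_rep.
  exact: cE.
exists r, I; split => // x Sx Ux.
exists U, pp, Q, p, A; split.
  split.
  - by split => //; exact: ball_open.
  - split; first by rewrite openE => w; exact: obox_open.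
    by move=> i; rewrite subrr normr0.
  - exact: Cinf_subset QU CA.
  - by move=> y Sy Uy; apply: toFRP; exact: RA.
move=> y Sy Uy; apply: fequiv_trans (fval y Sy (UV _ Uy)) _.
have [r' r'0 KO] := open_box oO (cE _ Uy).
have K0 : box (pt (fun i => std (p i)) (std y)) 0 (pt (fun i => rep (p i) 0) (rep y 0)).
  exact: box_center.
have small := pt_box_small (fun i => Ro_rep (p i)) (Ro_rep y) r'0 K0.
apply: fequiv_ev; apply: ev0W small => t t0 Ht.
by rewrite !ext_repE dA//; apply: KO => k; exact/ltW/Ht.
Qed.

(** * Gluing into a global primitive *)

Section Global.
Variables (f : FR R -> FR R) (u : FR R).
Hypotheses (sf : smooth_on S f) (Su : S u).

(** As [V] is an interval through [std u] and [I] vanishes at [u], any two such primitives agree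
    over the intersection of their sets. *)
Definition primitive_on (V : set R) I :=
  [/\ open V, is_interval V, V (std u), fequiv (rep (I u)) (fun=> 0) &
      forall x, S x -> V (std x) -> primitive_at S f I x].

Definition shift_by I d : FR R -> FR R := fun y => toFR (fun t => rep (I y) t + rep d t).

Lemma shift_byE I d y : fequiv (rep (shift_by I d y)) (fun t => rep (I y) t + rep d t).
Proof. by apply: toFRP; apply: RoD; exact: Ro_rep. Qed.

Lemma shift_to I x y : exists d, fequiv (rep (shift_by I d x)) (rep y).
Proof.
have Rd : Ro (fun t => rep y t - rep (I x) t).
  have := RoD (Ro_rep y) (RoM (Ro_cst (-1)) (Ro_rep (I x))).
  by congr (Ro _); apply/funext => t; rewrite mulN1r.
have [d dE] := FR_exists Rd; exists d.
apply: fequiv_trans (shift_byE _ _ _) _.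
apply: fequiv_trans (fequivD (fequiv_refl _) dE) _.
by apply: fequiv_ev; apply: ev0T => t _; rewrite addrC subrK.
Qed.

Lemma primitive_on_exists x : S x -> exists V I, primitive_on V I /\ V (std x).
Proof.
pose T := [set s | exists2 x, S x & std x = s].
move=> Sx; have Tx : T (std x) by exists x.
apply: (@interval_induction R T (fun s => exists V I, primitive_on V I /\ V s)
  (std u) std_interval _ _ _ (std x) Tx); first by exists u.
  have [rho [I [rho0 HI]]] := local_primitive sf Su.
  have [zero zeroE] := FR_exists (Ro_cst (0 : R)).
  have [d Hd] := shift_to I u zero.
  have uu : `|std u - std u| < rho by rewrite subrr normr0.
  exists [set s : R | `|s - std u| < rho], (shift_by I d); split => //; split => //.
  - exact: ball_open.
  - exact: ball_interval.
  - exact: fequiv_trans Hd zeroE.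
  - move=> y Sy yu; apply: (primitive_at_add (I := I) (d := d)); last exact: HI.
    by move=> z _; exact: shift_byE.
move=> s [w Sw <-].
have [rho [J [rho0 HJ]]] := local_primitive sf Sw.
pose B := [set s : R | `|s - std w| < rho].
exists rho => // s1 s2 [x1 Sx1 <-] [x2 Sx2 <-] r1 r2 [V [I [[oV iV Vu Iu HI] Vx1]]].
(* The primitive near [w] is adjusted to the value of [I] at [x1]; by uniqueness the two agree on
   the overlap, an interval containing [std x1]. *)
have [d Hd] := shift_to J x1 (I x1).
pose J' := shift_by J d.
have HJ' y : S y -> B (std y) -> primitive_at S f J' y.
  move=> Sy By; apply: (primitive_at_add (I := J) (d := d)); last exact: HJ.
  by move=> z _; exact: shift_byE.
have IJ' y : S y -> V (std y) -> B (std y) -> J' y = I y.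
  move=> Sy Vy By.
  apply: (@primitive_unique f J' I (V `&` B) x1) => //.
  - move=> p q [Vp Bp] [Vq Bq] v pq; split; first exact: iV pq.
    by apply: (@ball_interval (std w) rho p q).
  - by move=> z Sz [Vz Bz]; split; [exact: HJ'|exact: HI].
  - exact: FR_ext.
pose K y := if pselect (V (std y)) then I y else J' y.
have KI y : V (std y) -> K y = I y by rewrite /K; case: pselect.
have KJ y : S y -> B (std y) -> K y = J' y.
  by move=> Sy By; rewrite /K; case: pselect => // Vy; rewrite IJ'.
have oB : open B by exact: ball_open.
exists (V `|` B), K; split; last by right.
split.
- exact: openU.
- have /connected_intervalP cV := iV.
  have /connected_intervalP cB := @ball_interval (std w) rho.
  by apply/connected_intervalP; apply: connectedU => //; exists (std x1).
- by left.
- by rewrite KI.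
- move=> y Sy [Vy|By].
    by apply: (primitive_at_local oV Vy _ (HI y Sy Vy)) => z _; exact: KI.
  by apply: (primitive_at_local oB By _ (HJ' y Sy By)) => z; exact: KJ.
Qed.

(** Each point takes its value from a primitive chosen for it alone; agreement on intersections
    makes these values coincide near [x] with those of a single primitive. *)
Lemma primitive_exists_global : exists I,
  fequiv (rep (I u)) (fun=> 0) /\ forall x, S x -> primitive_at S f I x.
Proof.
have H x : exists VI : set R * (FR R -> FR R), S x -> primitive_on VI.1 VI.2 /\ VI.1 (std x).
  have [/primitive_on_exists[V [I HI]]|nS] := pselect (S x); first by exists (V, I).
  by exists (setT, id).
have [VI HVI] := choice _ H.
have [[_ _ _ Iu _] _] := HVI u Su.
exists (fun y => (VI y).2 y); split => // x Sx.
have [[oV iV Vu Ixu HI] Vx] := HVI x Sx.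
apply: (primitive_at_local oV Vx _ (HI x Sx Vx)) => y Sy Vy.
have [[oV' iV' Vu' Iyu HI'] Vy'] := HVI y Sy.
apply: (@primitive_unique f _ _ ((VI y).1 `&` (VI x).1) u) => //.
- by move=> p q [p1 p2] [q1 q2] v pq; split; [exact: iV' pq|exact: iV pq].
- by move=> z Sz [z1 z2]; split; [exact: HI'|exact: HI].
- by apply: FR_ext; exact: fequiv_trans Iyu (fequiv_sym Ixu).
Qed.

End Global.

End IntervalPrimitives.

Theorem theorem13 (R : realType) (a b : FRbar R) (k : ikind)
    (f : FR R -> FR R) (u : FR R) :
  FR_interval a b ->
  non_infinitesimal a b ->
  smooth_on (in_interval k a b) f ->
  in_interval k a b u ->
  exists I : FR R -> FR R,
    [/\ smooth_on (in_interval k a b) I,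
        (forall x, in_interval k a b x -> deriv_is (in_interval k a b) I x (f x)),
        FR_is_real (I u) 0 &
        forall I2 : FR R -> FR R,
          smooth_on (in_interval k a b) I2 ->
          (forall x, in_interval k a b x -> deriv_is (in_interval k a b) I2 x (f x)) ->
          FR_is_real (I2 u) 0 ->
          forall x, in_interval k a b x -> I2 x = I x].
Proof.
move=> _ ab sf Su.
have [I [Iu HI]] := primitive_exists_global sf Su.
exists I; split => //.
- exact: primitive_at_smooth HI.
- by move=> x Sx; exact: (primitive_at_deriv ab Sx (HI x Sx)).
move=> I2 sI2 dI2 I2u x Sx.
have HI2 := smooth_primitive_at sI2 dI2.
apply: (@primitive_unique R k a b f I2 I setT u) => //.
- by move=> y Sy _; split; [exact: HI2|exact: HI].
- by apply: FR_ext; exact: fequiv_trans I2u (fequiv_sym Iu).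
Qed.
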